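(* Let $H$ be a Hopf $^*$-algebra over $\mathsf{C}$. For idempotent non-degenerate $^*$-algebras $\mathcal{A},\mathcal{B}$ with $^*$-actions of $H$, regard $\mathsf{Pic}^*_H(\mathcal{B},\mathcal{A})$, the class of isomorphism classes of $H$-covariant $^*$-Morita equivalence $(\mathcal{B},\mathcal{A})$-bimodules, as the class of arrows $\mathcal{A}\to\mathcal{B}$. Then one obtains a (large) groupoid $\mathsf{Pic}^*_H$, where the composition is $[\mathcal{F}]\circ[\mathcal{E}]=[\mathcal{F}\,\widetilde{\otimes}_{\mathcal{B}}\,\mathcal{E}]$ for $[\mathcal{F}]\in\mathsf{Pic}^*_H(\mathcal{C},\mathcal{B})$ and $[\mathcal{E}]\in\mathsf{Pic}^*_H(\mathcal{B},\mathcal{A})$, the units are the $^*$-algebras $\mathcal{A}$ with the classes $[{}_{\mathcal{A}}\mathcal{A}_{\mathcal{A}}]$ of the canonical bimodules as unit arrows, and the inverse of $[\mathcal{E}]$ is the class $[\overline{\mathcal{E}}]$ of the complex conjugate bimodule. Similarly, replacing $^*$-Morita equivalence bimodules by strong Morita equivalence bimodules, the classes $\mathsf{Pic}^{\mathrm{str}}_H(\mathcal{B},\mathcal{A})$ form a groupoid $\mathsf{Pic}^{\mathrm{str}}_H$ with the same operations.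
   Context: **Ground ring.** $\mathsf{R}$ is an ordered ring (commutative, unital), $\mathsf{C}=\mathsf{R}(i)$ with $i^2=-1$, with complex conjugation. A $^*$-algebra over $\mathsf{C}$ is an associative $\mathsf{C}$-algebra with a $\mathsf{C}$-antilinear involutive antiautomorphism. It is *idempotent* if products $ab$ span it, *non-degenerate* if $a\mathcal{A}=0$ or $\mathcal{A}a=0$ implies $a=0$. For unital algebras, modules are unital. All modules carry a compatible $\mathsf{C}$-module structure. **Hopf $^*$-algebra.** $H$ is a Hopf algebra over $\mathsf{C}$ ($\Delta(g)=g_{(1)}\otimes g_{(2)}$, counit $\epsilon$, antipode $S$) which is also a $^*$-algebra such that $\Delta,\epsilon$ are $^*$-homomorphisms and $S(S(g)^* )^*=g$. A $^*$-action of $H$ on $\mathcal{A}$ is a left $H$-module structure (with $1_H\triangleright a=a$) with $g\triangleright(ab)=(g_{(1)}\triangleright a)(g_{(2)}\triangleright b)$, $(g\triangleright a)^*=S(g)^*\triangleright a^*$, and $g\triangleright1=\epsilon(g)1$ if $\mathcal{A}$ is unital. **Positivity and inner products.** $\omega:\mathcal{A}\to\mathsf{C}$ linear is positive if $\omega(a^*a)\ge0$; $a$ is positive if $\omega(a)\ge0$ for all positive $\omega$. An $\mathcal{A}$-valued inner product on a right $\mathcal{A}$-module is $\mathsf{C}$-sesquilinear (linear in the second argument) with $\langle x,y\cdot a\rangle=\langle x,y\rangle a$, $\langle x,y\rangle=\langle y,x\rangle^*$ (on left modules: left linear in the first argument). It is non-degenerate if $\langle x,\cdot\rangle=0$ implies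 $x=0$, full if its values span the algebra, completely positive if $(\langle x_i,x_j\rangle)$ is positive in $M_n$ of the algebra for all $n$, $x_1,\dots,x_n$. **Equivalence bimodules.** An $H$-covariant $^*$-(Morita) equivalence bimodule is a $(\mathcal{B},\mathcal{A})$-bimodule $\mathcal{E}$ with $\mathcal{B}\cdot\mathcal{E}=\mathcal{E}=\mathcal{E}\cdot\mathcal{A}$ (spans), full non-degenerate inner products ${}_{\mathcal{B}}\langle\cdot,\cdot\rangle$ (left $\mathcal{B}$-linear) and $\langle\cdot,\cdot\rangle_{\mathcal{A}}$ (right $\mathcal{A}$-linear) with $\langle b\cdot x,y\rangle_{\mathcal{A}}=\langle x,b^*\cdot y\rangle_{\mathcal{A}}$, ${}_{\mathcal{B}}\langle x\cdot a,y\rangle={}_{\mathcal{B}}\langle x,y\cdot a^*\rangle$, ${}_{\mathcal{B}}\langle x,y\rangle\cdot z=x\cdot\langle y,z\rangle_{\mathcal{A}}$, and an $H$-module structure with $g\triangleright\langle x,y\rangle_{\mathcal{A}}=\langle S(g_{(1)})^*\triangleright x,g_{(2)}\triangleright y\rangle_{\mathcal{A}}$, $g\triangleright{}_{\mathcal{B}}\langle x,y\rangle={}_{\mathcal{B}}\langle g_{(1)}\triangleright x,S(g_{(2)})^*\triangleright y\rangle$. It is *strong* if both inner products are completely positive. Isomorphisms are $H$-equivariant bimodule isomorphisms preserving both inner products. **Operations.** $\mathcal{F}\widetilde{\otimes}_{\mathcal{B}}\mathcal{E}$ is $\mathcal{F}\otimes_{\mathcal{B}}\mathcal{E}$ with inner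 products $\langle y\otimes x,y'\otimes x'\rangle_{\mathcal{A}}=\langle x,\langle y,y'\rangle_{\mathcal{B}}\cdot x'\rangle_{\mathcal{A}}$ and ${}_{\mathcal{C}}\langle y\otimes x,y'\otimes x'\rangle={}_{\mathcal{C}}\langle y\cdot{}_{\mathcal{B}}\langle x,x'\rangle,y'\rangle$, divided by the degeneracy space (the same for both inner products), with $g\triangleright(y\otimes x)=g_{(1)}\triangleright y\otimes g_{(2)}\triangleright x$. The canonical bimodule ${}_{\mathcal{A}}\mathcal{A}_{\mathcal{A}}$ has $\langle a,b\rangle_{\mathcal{A}}=a^*b$, ${}_{\mathcal{A}}\langle a,b\rangle=ab^*$ and the given $H$-action. $\overline{\mathcal{E}}$ is the conjugate $\mathsf{C}$-module with elements $\overline{x}$, $a\cdot\overline{x}=\overline{x\cdot a^*}$, $\overline{x}\cdot b=\overline{b^*\cdot x}$, ${}_{\mathcal{A}}\langle\overline{x},\overline{y}\rangle=\langle x,y\rangle_{\mathcal{A}}$, $\langle\overline{x},\overline{y}\rangle_{\mathcal{B}}={}_{\mathcal{B}}\langle x,y\rangle$, $g\triangleright\overline{x}=\overline{S(g)^*\triangleright x}$. ''Large'' means set-theoretic size issues are ignored. *)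

(* Defs.v *)
From HB Require Import structures.
From mathcomp Require Import all_boot all_order all_algebra.
From mathcomp Require Import boolp complex.

Set Implicit Arguments.
Unset Strict Implicit.
Unset Printing Implicit Defensive.

Import Order.TTheory GRing.Theory Num.Theory.

Local Open Scope ring_scope.
Local Open Scope quotient_scope.

(* The ring R(i).  The library makes R[i] a ring only over a field, whence an
   alias carrying the same addition and multiplication over an ordered ring. *)
Definition Cx (R : realDomainType) : Type := R[i]%C.

HB.instance Definition _ (R : realDomainType) := GRing.Zmodule.on (Cx R).

Section CxRing.
Variable R : realDomainType.

Definition Cx1 : Cx R := Complex 1 0.
Definition Cxmul (x y : Cx R) : Cx R := ComplexField.mulc x y.

Lemma CxmulA : associative Cxmul. Proof. exact: ComplexField.mulcA. Qed.
Lemma CxmulC : commutative Cxmul. Proof. exact: ComplexField.mulcC. Qed.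

Lemma Cxmul1 : left_id Cx1 Cxmul.
Proof.
by move=> [a b]; rewrite /Cxmul /= !mul1r !mul0r subr0 addr0.
Qed.

Lemma CxmulDl : left_distributive Cxmul +%R.
Proof.
move=> [a b] [c d] [e f]; rewrite -[RHS]/(ComplexField.addc _ _) /Cxmul /=.
rewrite !mulrDl !opprD -!addrA.
by congr (Complex (_ + _) (_ + _)); rewrite addrCA.
Qed.

Lemma Cx1_neq0 : Cx1 != 0.
Proof. by apply/eqP => /(congr1 (@complex.Re R))/eqP; rewrite oner_eq0. Qed.

HB.instance Definition _ :=
  GRing.Zmodule_isComNzRing.Build (Cx R) CxmulA CxmulC Cxmul1 CxmulDl Cx1_neq0.

Definition cconj (z : Cx R) : Cx R := conjc z.

(* z >= 0 in C: z lies in R and is nonnegative there. *)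
Definition cge0 (z : Cx R) : Prop := 0 <= complex.Re z /\ complex.Im z = 0.

Lemma cconjK : involutive cconj.
Proof. by move=> [a b]; rewrite /cconj /= opprK. Qed.

Lemma cconjM z w : cconj (z * w) = cconj z * cconj w.
Proof.
case: z w => [a b] [c d]; congr (Complex _ _); rewrite ?mulrNN //.
by rewrite mulrN mulNr opprD.
Qed.

Lemma cconjD z w : cconj (z + w) = cconj z + cconj w.
Proof. by case: z w => [a b] [c d]; congr (Complex _ _); rewrite opprD. Qed.

Lemma cconj1 : cconj 1 = 1.
Proof. by congr (Complex _ _); rewrite oppr0. Qed.

End CxRing.

Section Span.
Variables (K : pzRingType) (V : lmodType K).

Definition in_span (P : V -> Prop) (v : V) : Prop :=
  exists s : seq (K * V),
    (forall p, p \in s -> P p.2) /\ v = \sum_(p <- s) p.1 *: p.2.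

Definition spans (P : V -> Prop) : Prop := forall v, in_span P v.

Lemma in_span0 P : in_span P 0.
Proof. by exists [::]; split => //; rewrite big_nil. Qed.

Lemma in_spanD P u v : in_span P u -> in_span P v -> in_span P (u + v).
Proof.
move=> [s [Ps ->]] [t [Pt ->]]; exists (s ++ t); split; last by rewrite big_cat.
by move=> p; rewrite mem_cat => /orP[/Ps|/Pt].
Qed.

Lemma in_spanZ P c v : in_span P v -> in_span P (c *: v).
Proof.
move=> [s [Ps ->]]; exists [seq (c * p.1, p.2) | p <- s]; split.
  by move=> _ /mapP[p /Ps Pp ->].
by rewrite big_map scaler_sumr; apply: eq_bigr => p _; rewrite scalerA.
Qed.

Lemma in_spanN P v : in_span P v -> in_span P (- v).
Proof. by rewrite -scaleN1r; apply: in_spanZ. Qed.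

End Span.

Section QuotientModule.
Variables (K : pzRingType) (V : lmodType K) (P : V -> Prop).

Definition quot_rel : rel V := fun u v => `[< in_span P (u - v) >].

Lemma quot_rel_equiv : equiv_class_of quot_rel.
Proof.
split=> [v|u v|v u w].
- by apply/asboolP; rewrite subrr; apply: in_span0.
- by apply/asboolP/asboolP => /in_spanN; rewrite opprB.
- move=> /asboolP uv /asboolP vw; apply/asboolP.
  by rewrite -(subrKA v); apply: in_spanD.
Qed.

Canonical quot_equiv := EquivRelPack quot_rel_equiv.

(* V modulo the submodule generated by P *)
Definition quot_mod : Type := {eq_quot quot_equiv}.

HB.instance Definition _ := Choice.on quot_mod.
HB.instance Definition _ := EqQuotient.on quot_mod.

Definition qcls (v : V) : quot_mod := \pi_quot_mod v.

Lemma qclsP u v : qcls u = qcls v <-> in_span P (u - v).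
Proof. by split=> [/eqmodP/asboolP|uv] //; apply/eqmodP/asboolP. Qed.

Definition qadd (q r : quot_mod) := qcls (repr q + repr r).
Definition qopp (q : quot_mod) := qcls (- repr q).
Definition qscale (c : K) (q : quot_mod) := qcls (c *: repr q).

Lemma qind (Q : quot_mod -> Prop) : (forall v, Q (qcls v)) -> forall q, Q q.
Proof. by move=> Qv q; rewrite -[q]reprK; apply: Qv. Qed.

Lemma qrepr v : in_span P (repr (qcls v) - v).
Proof. by apply/qclsP; rewrite /qcls reprK. Qed.

Lemma qaddE u v : qadd (qcls u) (qcls v) = qcls (u + v).
Proof.
apply/qclsP; rewrite opprD addrACA; apply: in_spanD; exact: qrepr.
Qed.

Lemma qoppE u : qopp (qcls u) = qcls (- u).
Proof. apply/qclsP; rewrite -opprD; apply: in_spanN; exact: qrepr. Qed.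

Lemma qscaleE c u : qscale c (qcls u) = qcls (c *: u).
Proof. apply/qclsP; rewrite -scalerBr; apply: in_spanZ; exact: qrepr. Qed.

Lemma qaddA : associative qadd.
Proof.
by elim/qind=> u; elim/qind=> v; elim/qind=> w; rewrite !qaddE addrA.
Qed.

Lemma qaddC : commutative qadd.
Proof. by elim/qind=> u; elim/qind=> v; rewrite !qaddE addrC. Qed.

Lemma qadd0 : left_id (qcls 0) qadd.
Proof. by elim/qind=> u; rewrite qaddE add0r. Qed.

Lemma qaddN : left_inverse (qcls 0) qopp qadd.
Proof. by elim/qind=> u; rewrite qoppE qaddE addNr. Qed.

HB.instance Definition _ :=
  GRing.isZmodule.Build quot_mod qaddA qaddC qadd0 qaddN.

Lemma qclsD u v : qcls u + qcls v = qcls (u + v).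
Proof. exact: qaddE. Qed.

Lemma qscaleA a b q : qscale a (qscale b q) = qscale (a * b) q.
Proof. by elim/qind: q => u; rewrite !qscaleE scalerA. Qed.

Lemma qscale1 : left_id 1 qscale.
Proof. by elim/qind=> u; rewrite qscaleE scale1r. Qed.

Lemma qscaleDr : right_distributive qscale +%R.
Proof.
move=> c; elim/qind=> u; elim/qind=> v.
by rewrite qclsD !qscaleE qclsD scalerDr.
Qed.

Lemma qscaleDl q : {morph qscale^~ q : a b / a + b}.
Proof.
elim/qind: q => u a b.
by rewrite !qscaleE qclsD scalerDl.
Qed.

HB.instance Definition _ :=
  GRing.Zmodule_isLmodule.Build K quot_mod qscaleA qscale1 qscaleDr qscaleDl.

End QuotientModule.

(* The tensor product over K.  A list of pairs stands for the sum of the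
   corresponding simple tensors. *)
Section TensorProduct.
Variables (K : comNzRingType) (M N : lmodType K).

Inductive tens_eq : seq (M * N) -> seq (M * N) -> Prop :=
| tens_refl s : tens_eq s s
| tens_sym s t : tens_eq s t -> tens_eq t s
| tens_trans s t u : tens_eq s t -> tens_eq t u -> tens_eq s u
| tens_cat s s' t t' : tens_eq s s' -> tens_eq t t' -> tens_eq (s ++ t) (s' ++ t')
| tens_comm s t : tens_eq (s ++ t) (t ++ s)
| tens_0l y : tens_eq [:: (0, y)] [::]
| tens_Dl x x' y : tens_eq [:: (x + x', y)] [:: (x, y); (x', y)]
| tens_Dr x y y' : tens_eq [:: (x, y + y')] [:: (x, y); (x, y')]
| tens_Z c x y : tens_eq [:: (c *: x, y)] [:: (x, c *: y)].

Definition tens_rel : rel (seq (M * N)) := fun s t => `[< tens_eq s t >].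

Lemma tens_rel_equiv : equiv_class_of tens_rel.
Proof.
split=> [s|s t|t s u].
- by apply/asboolP; apply: tens_refl.
- by apply/asboolP/asboolP; apply: tens_sym.
- move=> /asboolP st /asboolP tu; apply/asboolP; exact: tens_trans st tu.
Qed.

Canonical tens_equiv := EquivRelPack tens_rel_equiv.

Definition tensor : Type := {eq_quot tens_equiv}.

HB.instance Definition _ := Choice.on tensor.
HB.instance Definition _ := EqQuotient.on tensor.

Definition tcls (s : seq (M * N)) : tensor := \pi_tensor s.

Definition tpure (x : M) (y : N) : tensor := tcls [:: (x, y)].

Lemma tclsP s t : tcls s = tcls t <-> tens_eq s t.
Proof. by split=> [/eqmodP/asboolP|st] //; apply/eqmodP/asboolP. Qed.

Lemma tcls_ind (Q : tensor -> Prop) : (forall s, Q (tcls s)) -> forall t, Q t.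
Proof. by move=> Qs t; rewrite -[t]reprK; apply: Qs. Qed.

Lemma trepr s : tens_eq (repr (tcls s)) s.
Proof. by apply/tclsP; rewrite /tcls reprK. Qed.

Definition scale_pair (c : K) (p : M * N) := (c *: p.1, p.2).

Definition tadd (t u : tensor) := tcls (repr t ++ repr u).
Definition tscale (c : K) (t : tensor) := tcls [seq scale_pair c p | p <- repr t].
Definition topp (t : tensor) := tscale (-1) t.

Lemma tens_eq_scale c s t : tens_eq s t ->
  tens_eq [seq scale_pair c p | p <- s] [seq scale_pair c p | p <- t].
Proof.
elim=> {s t} [s|s t _ IH|s t u _ IH1 _ IH2|s s' t t' _ IH1 _ IH2|s t|y|x x' y|
              x y y'|d x y] /=.
- exact: tens_refl.
- exact: tens_sym.
- exact: tens_trans IH1 IH2.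
- by rewrite !map_cat; apply: tens_cat.
- by rewrite !map_cat; apply: tens_comm.
- by rewrite /scale_pair /= scaler0; apply: tens_0l.
- by rewrite /scale_pair /= scalerDr; apply: tens_Dl.
- exact: tens_Dr.
- by rewrite /scale_pair /= scalerA mulrC -scalerA; apply: tens_Z.
Qed.

Lemma taddE s t : tadd (tcls s) (tcls t) = tcls (s ++ t).
Proof. by apply/tclsP; apply: tens_cat; apply: trepr. Qed.

Lemma tscaleE c s : tscale c (tcls s) = tcls [seq scale_pair c p | p <- s].
Proof. by apply/tclsP; apply: tens_eq_scale; apply: trepr. Qed.

Lemma taddA : associative tadd.
Proof.
by elim/tcls_ind=> s; elim/tcls_ind=> t; elim/tcls_ind=> u; rewrite !taddE catA.
Qed.

Lemma taddC : commutative tadd.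
Proof.
by elim/tcls_ind=> s; elim/tcls_ind=> t; rewrite !taddE; apply/tclsP/tens_comm.
Qed.

Lemma tadd0 : left_id (tcls [::]) tadd.
Proof. by elim/tcls_ind=> s; rewrite taddE. Qed.

Lemma tscaleDl t : {morph tscale^~ t : a b / a + b >-> tadd a b}.
Proof.
elim/tcls_ind: t => s a b; rewrite !tscaleE taddE; apply/tclsP.
elim: s => [|[x y] s IH] /=; first exact: tens_refl.
apply: (@tens_trans _ ([:: (a *: x, y); (b *: x, y)] ++
    ([seq scale_pair a p | p <- s] ++ [seq scale_pair b p | p <- s]))).
  rewrite -cat1s; apply: tens_cat IH.
  by rewrite /scale_pair /= scalerDl; apply: tens_Dl.
rewrite /= -cat1s -[X in tens_eq _ X]cat1s; apply: tens_cat; first exact: tens_refl.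
rewrite -cat1s -[X in tens_eq _ (_ ++ X)]cat1s !catA; apply: tens_cat.
  exact: tens_comm.
exact: tens_refl.
Qed.

Lemma taddN : left_inverse (tcls [::]) topp tadd.
Proof.
elim/tcls_ind=> s; have s1 : tcls s = tscale 1 (tcls s).
  rewrite tscaleE; congr tcls; elim: s => //= -[x y] s <-.
  by rewrite /scale_pair /= scale1r.
rewrite /topp [X in tadd _ X]s1 -tscaleDl addNr tscaleE; apply/tclsP.
elim: s {s1} => [|[x y] s IH] /=; first exact: tens_refl.
rewrite -cat1s -[[::]]cats0; apply: tens_cat IH.
by rewrite /scale_pair /= scale0r; apply: tens_0l.
Qed.

HB.instance Definition _ := GRing.isZmodule.Build tensor taddA taddC tadd0 taddN.

Lemma tclsD s t : tcls s + tcls t = tcls (s ++ t).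
Proof. exact: taddE. Qed.

Lemma tscaleA a b t : tscale a (tscale b t) = tscale (a * b) t.
Proof.
elim/tcls_ind: t => s; rewrite !tscaleE -map_comp; congr tcls.
by apply: eq_map => -[x y]; rewrite /scale_pair /= scalerA.
Qed.

Lemma tscale1 : left_id 1 tscale.
Proof.
elim/tcls_ind=> s; rewrite tscaleE; congr tcls; elim: s => //= -[x y] s ->.
by rewrite /scale_pair /= scale1r.
Qed.

Lemma tscaleDr : right_distributive tscale +%R.
Proof.
move=> c; elim/tcls_ind=> s; elim/tcls_ind=> t.
by rewrite tclsD !tscaleE tclsD map_cat.
Qed.

HB.instance Definition _ :=
  GRing.Zmodule_isLmodule.Build K tensor tscaleA tscale1 tscaleDr tscaleDl.

(* The additive map sending x (x) y to f x y.  It is independent of the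
   representative as soon as f is biadditive with f (c x) y = f x (c y); f need
   not be linear, which is what the conjugate-linear maps below require. *)
Definition tlift (V : nmodType) (f : M -> N -> V) (t : tensor) : V :=
  \sum_(p <- repr t) f p.1 p.2.

Section Lift.
Variables (V : zmodType) (f : M -> N -> V).
Hypothesis fDl : forall x x' y, f (x + x') y = f x y + f x' y.
Hypothesis fDr : forall x y y', f x (y + y') = f x y + f x y'.
Hypothesis fZ : forall c x y, f (c *: x) y = f x (c *: y).

Lemma tlift_cls s : tlift f (tcls s) = \sum_(p <- s) f p.1 p.2.
Proof.
have f0 y : f 0 y = 0 by apply: (addIr (f 0 y)); rewrite -fDl !add0r.
rewrite /tlift; move: (repr _) (trepr s) => t.
elim=> {s t} [//|s t _ -> //|s t u _ -> _ -> //|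
  s s' t t' _ IH1 _ IH2|s t|y|x x' y|x y y'|c x y].
- by rewrite !big_cat /= IH1 IH2.
- by rewrite !big_cat /= addrC.
- by rewrite big_seq1 big_nil f0.
- by rewrite !big_cons !big_nil !addr0 fDl.
- by rewrite !big_cons !big_nil !addr0 fDr.
- by rewrite !big_seq1 fZ.
Qed.

Lemma tliftE x y : tlift f (tpure x y) = f x y.
Proof. by rewrite tlift_cls big_seq1. Qed.

Lemma tliftD : {morph tlift f : t u / t + u}.
Proof.
elim/tcls_ind=> s; elim/tcls_ind=> t.
by rewrite tclsD !tlift_cls big_cat.
Qed.

End Lift.
End TensorProduct.

Arguments tpure {K M N} x y.

(* A possibly non-unital *-algebra over C = R(i). *)
Record star_alg (R : realDomainType) := StarAlg {
  sa_car :> lmodType (Cx R);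
  sa_mul : sa_car -> sa_car -> sa_car;
  sa_star : sa_car -> sa_car;
  sa_mulA : associative sa_mul;
  sa_mul_linl : forall a, linear (sa_mul^~ a);
  sa_mul_linr : forall a, linear (sa_mul a);
  sa_starD : {morph sa_star : a b / a + b};
  sa_starZ : forall c a, sa_star (c *: a) = cconj c *: sa_star a;
  sa_starK : involutive sa_star;
  sa_starM : forall a b, sa_star (sa_mul a b) = sa_mul (sa_star b) (sa_star a)
}.

Section StarAlgebras.
Variables (R : realDomainType) (A : star_alg R).

Definition sa_unit (e : A) : Prop := forall a, sa_mul e a = a /\ sa_mul a e = a.

Definition idempotent_alg : Prop :=
  spans (fun c : A => exists a b, c = sa_mul a b).

Definition nondegenerate_alg : Prop :=
  (forall a : A, (forall b, sa_mul a b = 0) -> a = 0) /\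
  (forall a : A, (forall b, sa_mul b a = 0) -> a = 0).

Definition positive_functional (w : A -> Cx R) : Prop :=
  scalar w /\ forall a, cge0 (w (sa_mul (sa_star a) a)).

Definition positive_elt (a : A) : Prop :=
  forall w, positive_functional w -> cge0 (w a).

Lemma sa_mul0l b : sa_mul 0 b = 0 :> A.
Proof.
by have := @sa_mul_linl _ A b (-1) 0 0; rewrite !scaleN1r oppr0 addr0 addNr.
Qed.

Lemma sa_mul0r a : sa_mul a 0 = 0 :> A.
Proof.
by have := @sa_mul_linr _ A a (-1) 0 0; rewrite !scaleN1r oppr0 addr0 addNr.
Qed.

Lemma sa_mulDl (a a' b : A) : sa_mul (a + a') b = sa_mul a b + sa_mul a' b.
Proof. by have := @sa_mul_linl _ A b 1 a a'; rewrite !scale1r. Qed.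

Lemma sa_mulDr (a b b' : A) : sa_mul a (b + b') = sa_mul a b + sa_mul a b'.
Proof. by have := @sa_mul_linr _ A a 1 b b'; rewrite !scale1r. Qed.

Lemma sa_star0 : sa_star 0 = 0 :> A.
Proof. by apply: (addIr (sa_star 0)); rewrite -sa_starD !add0r. Qed.

Lemma sa_mul_suml n (F : 'I_n -> A) b :
  sa_mul (\sum_i F i) b = \sum_i sa_mul (F i) b.
Proof.
elim/big_rec2: _ => [|i x y _ <-]; first exact: sa_mul0l.
exact: sa_mulDl.
Qed.

Lemma sa_mul_sumr n (F : 'I_n -> A) a :
  sa_mul a (\sum_i F i) = \sum_i sa_mul a (F i).
Proof.
elim/big_rec2: _ => [|i x y _ <-]; first exact: sa_mul0r.
exact: sa_mulDr.
Qed.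

End StarAlgebras.

(* M_n(A); the library has no C-module structure on matrices whose entries lie
   in a C-module, so matrices are functions of the pair of indices. *)
Section MatrixStarAlgebra.
Variables (R : realDomainType) (A : star_alg R) (n : nat).

Definition mxsa : lmodType (Cx R) := {ffun 'I_n * 'I_n -> A}.

Definition mxsa_mul (X Y : mxsa) : mxsa :=
  [ffun p => \sum_k sa_mul (X (p.1, k)) (Y (k, p.2))].

Definition mxsa_star (X : mxsa) : mxsa := [ffun p => sa_star (X (p.2, p.1))].

Lemma mxsa_mulA : associative mxsa_mul.
Proof.
move=> X Y Z; apply/ffunP=> p; rewrite !ffunE.
under eq_bigr => k _ do rewrite ffunE sa_mul_sumr.
rewrite exchange_big; apply: eq_bigr => l _ /=.
by rewrite ffunE sa_mul_suml; apply: eq_bigr => k _; rewrite sa_mulA.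
Qed.

Lemma mxsa_mul_linl Y : linear (mxsa_mul^~ Y).
Proof.
move=> c X X'; apply/ffunP=> p; rewrite !ffunE scaler_sumr -big_split /=.
by apply: eq_bigr => k _; rewrite !ffunE sa_mul_linl.
Qed.

Lemma mxsa_mul_linr X : linear (mxsa_mul X).
Proof.
move=> c Y Y'; apply/ffunP=> p; rewrite !ffunE scaler_sumr -big_split /=.
by apply: eq_bigr => k _; rewrite !ffunE sa_mul_linr.
Qed.

Lemma mxsa_starD : {morph mxsa_star : X Y / X + Y}.
Proof. by move=> X Y; apply/ffunP=> p; rewrite !ffunE sa_starD. Qed.

Lemma mxsa_starZ c X : mxsa_star (c *: X) = cconj c *: mxsa_star X.
Proof. by apply/ffunP=> p; rewrite !ffunE sa_starZ. Qed.

Lemma mxsa_starK : involutive mxsa_star.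
Proof. by move=> X; apply/ffunP=> -[i j]; rewrite !ffunE sa_starK. Qed.

Lemma mxsa_starM X Y :
  mxsa_star (mxsa_mul X Y) = mxsa_mul (mxsa_star Y) (mxsa_star X).
Proof.
apply/ffunP=> p; rewrite !ffunE (big_morph _ (@sa_starD _ A) (@sa_star0 _ A)).
by apply: eq_bigr => k _; rewrite !ffunE sa_starM.
Qed.

Definition mx_star_alg : star_alg R :=
  StarAlg mxsa_mulA mxsa_mul_linl mxsa_mul_linr mxsa_starD mxsa_starZ
          mxsa_starK mxsa_starM.

End MatrixStarAlgebra.

(* Products in H (x) H, the iterated coproduct and Sweedler sums are maps
   induced on the tensor product, see tlift. *)
Definition tens_mul (K : comNzRingType) (H : algType K) (t u : tensor H H) :
    tensor H H :=
  tlift (fun a b => tlift (fun c d => tpure (a * c) (b * d)) u) t.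

Record hopf_star_alg (R : realDomainType) := HopfStarAlg {
  hs_car :> algType (Cx R);
  hs_Delta : hs_car -> tensor hs_car hs_car;
  hs_eps : hs_car -> Cx R;
  hs_S : hs_car -> hs_car;
  hs_star : hs_car -> hs_car;
  hs_Delta_lin : linear hs_Delta;
  hs_Delta1 : hs_Delta 1 = tpure 1 1;
  hs_DeltaM : forall g h, hs_Delta (g * h) = tens_mul (hs_Delta g) (hs_Delta h);
  hs_eps_lin : scalar hs_eps;
  hs_eps1 : hs_eps 1 = 1;
  hs_epsM : {morph hs_eps : g h / g * h};
  hs_coassoc : forall g,
    tlift (fun a b => tlift (fun a1 a2 => tpure a1 (tpure a2 b)) (hs_Delta a))
          (hs_Delta g)
    = tlift (fun a b => tpure a (hs_Delta b)) (hs_Delta g);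
  hs_counitl : forall g, tlift (fun a b => hs_eps a *: b) (hs_Delta g) = g;
  hs_counitr : forall g, tlift (fun a b => hs_eps b *: a) (hs_Delta g) = g;
  hs_S_lin : linear hs_S;
  hs_antipodel : forall g,
    tlift (fun a b => hs_S a * b) (hs_Delta g) = hs_eps g *: 1;
  hs_antipoder : forall g,
    tlift (fun a b => a * hs_S b) (hs_Delta g) = hs_eps g *: 1;
  hs_starD : {morph hs_star : g h / g + h};
  hs_starZ : forall c g, hs_star (c *: g) = cconj c *: hs_star g;
  hs_starK : involutive hs_star;
  hs_starM : forall g h, hs_star (g * h) = hs_star h * hs_star g;
  hs_Delta_star : forall g,
    hs_Delta (hs_star g)
    = tlift (fun a b => tpure (hs_star a) (hs_star b)) (hs_Delta g);
  hs_eps_star : forall g, hs_eps (hs_star g) = cconj (hs_eps g);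
  hs_S_star : forall g, hs_star (hs_S (hs_star (hs_S g))) = g
}.

Section Actions.
Variables (R : realDomainType) (H : hopf_star_alg R).

Record is_Hmodule (V : lmodType (Cx R)) (act : H -> V -> V) : Prop := {
  Hmod_linr : forall g, linear (act g);
  Hmod_linl : forall v, linear (act^~ v);
  Hmod_1 : forall v, act 1 v = v;
  Hmod_M : forall g h v, act (g * h) v = act g (act h v)
}.

Record is_star_action (A : star_alg R) (act : H -> A -> A) : Prop := {
  sact_Hmodule : is_Hmodule act;
  sact_mul : forall g a b,
    act g (sa_mul a b)
    = tlift (fun g1 g2 => sa_mul (act g1 a) (act g2 b)) (hs_Delta g);
  sact_star : forall g a,
    sa_star (act g a) = act (hs_star (hs_S g)) (sa_star a);
  sact_unit : forall e, sa_unit e -> forall g, act g e = hs_eps g *: e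
}.

(* The units of the groupoids: idempotent non-degenerate *-algebras with a
   *-action of H. *)
Record Hstar_alg := HStarAlg {
  ha_alg :> star_alg R;
  ha_act : H -> ha_alg -> ha_alg;
  ha_actP : is_star_action ha_act;
  ha_idem : idempotent_alg ha_alg;
  ha_nondeg : nondegenerate_alg ha_alg
}.

(* The data of a (B, A)-bimodule with two inner products and an action of H;
   its axioms are those of is_equiv_bimod. *)
Record bimod (B A : Hstar_alg) := Bimod {
  bm_car :> lmodType (Cx R);
  lact : B -> bm_car -> bm_car;
  ract : bm_car -> A -> bm_car;
  lip : bm_car -> bm_car -> B;
  rip : bm_car -> bm_car -> A;
  bm_act : H -> bm_car -> bm_car
}.

Definition completely_positive (A : star_alg R) (E : Type) (ip : E -> E -> A) :
    Prop :=
  forall (n : nat) (x : 'I_n -> E),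
    positive_elt (A := mx_star_alg A n) [ffun p => ip (x p.1) (x p.2)].

Record is_equiv_bimod (B A : Hstar_alg) (E : bimod B A) : Prop := {
  lact_linl : forall x, linear (fun b => lact b x : E);
  lact_linr : forall b, linear (fun x : E => lact b x);
  lactA : forall b b' (x : E), lact (sa_mul b b') x = lact b (lact b' x);
  ract_linl : forall a, linear (fun x : E => ract x a);
  ract_linr : forall x, linear (fun a => ract x a : E);
  ractA : forall (x : E) a a', ract x (sa_mul a a') = ract (ract x a) a';
  lract : forall b (x : E) a, ract (lact b x) a = lact b (ract x a);
  lact_spans : spans (fun z : E => exists b x, z = lact b x);
  ract_spans : spans (fun z : E => exists x a, z = ract x a);
  rip_lin : forall x, linear (fun y : E => rip x y);
  rip_sym : forall x y : E, rip x y = sa_star (rip y x);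
  rip_ract : forall (x y : E) a, rip x (ract y a) = sa_mul (rip x y) a;
  rip_nondeg : forall x : E, (forall y, rip x y = 0) -> x = 0;
  rip_full : spans (fun a : A => exists x y : E, a = rip x y);
  lip_lin : forall y, linear (fun x : E => lip x y);
  lip_sym : forall x y : E, lip x y = sa_star (lip y x);
  lip_lact : forall b (x y : E), lip (lact b x) y = sa_mul b (lip x y);
  lip_nondeg : forall x : E, (forall y, lip x y = 0) -> x = 0;
  lip_full : spans (fun b : B => exists x y : E, b = lip x y);
  rip_lact : forall b (x y : E), rip (lact b x) y = rip x (lact (sa_star b) y);
  lip_ract : forall (x y : E) a, lip (ract x a) y = lip x (ract y (sa_star a));
  lip_rip : forall x y z : E, lact (lip x y) z = ract x (rip y z);
  bm_Hmodule : is_Hmodule (@bm_act _ _ E);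
  bm_act_rip : forall g (x y : E),
    ha_act g (rip x y)
    = tlift (fun g1 g2 => rip (bm_act (hs_star (hs_S g1)) x) (bm_act g2 y))
            (hs_Delta g);
  bm_act_lip : forall g (x y : E),
    ha_act g (lip x y)
    = tlift (fun g1 g2 => lip (bm_act g1 x) (bm_act (hs_star (hs_S g2)) y))
            (hs_Delta g)
}.

Record is_strong_equiv_bimod (B A : Hstar_alg) (E : bimod B A) : Prop := {
  strong_equiv : is_equiv_bimod E;
  strong_lip_cp : completely_positive (@lip _ _ E);
  strong_rip_cp : completely_positive (@rip _ _ E)
}.

Definition bimod_iso (B A : Hstar_alg) (E E' : bimod B A) : Prop :=
  exists f : E -> E',
    [/\ linear f, bijective f,
        (forall b x, f (lact b x) = lact b (f x)) /\
        (forall x a, f (ract x a) = ract (f x) a),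
        (forall x y, lip (f x) (f y) = lip x y) /\
        (forall x y, rip (f x) (f y) = rip x y)
      & forall g x, f (bm_act g x) = bm_act g (f x)].

Definition canonical_bimod (A : Hstar_alg) : bimod A A := {|
  bm_car := A;
  lact := @sa_mul _ A;
  ract := @sa_mul _ A;
  lip := fun a b => sa_mul a (sa_star b);
  rip := fun a b => sa_mul (sa_star a) b;
  bm_act := @ha_act A
|}.

End Actions.

Section ConjugateModule.
Variables (R : realDomainType) (V : lmodType (Cx R)).

Definition conj_mod : Type := V.

HB.instance Definition _ := GRing.Zmodule.on conj_mod.

Definition conj_scale (c : Cx R) (x : conj_mod) : conj_mod :=
  cconj c *: (x : V).

Lemma conj_scaleA a b x : conj_scale a (conj_scale b x) = conj_scale (a * b) x.
Proof. by rewrite /conj_scale scalerA cconjM. Qed.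

Lemma conj_scale1 : left_id 1 conj_scale.
Proof. by move=> x; rewrite /conj_scale cconj1 scale1r. Qed.

Lemma conj_scaleDr : right_distributive conj_scale +%R.
Proof. by move=> c x y; rewrite /conj_scale scalerDr. Qed.

Lemma conj_scaleDl x : {morph conj_scale^~ x : a b / a + b}.
Proof. by move=> a b; rewrite /conj_scale cconjD scalerDl. Qed.

HB.instance Definition _ := GRing.Zmodule_isLmodule.Build (Cx R) conj_mod
  conj_scaleA conj_scale1 conj_scaleDr conj_scaleDl.

End ConjugateModule.

Section Operations.
Variables (R : realDomainType) (H : hopf_star_alg R).

Definition conj_bimod (B A : Hstar_alg H) (E : bimod B A) : bimod A B := {|
  bm_car := conj_mod E;
  lact := fun a (x : E) => ract x (sa_star a);
  ract := fun (x : E) b => lact (sa_star b) x;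
  lip := fun x y : E => rip x y;
  rip := fun x y : E => lip x y;
  bm_act := fun g (x : E) => bm_act (hs_star (hs_S g)) x
|}.

Section TensorBimodule.
Variables (C B A : Hstar_alg H) (F : bimod C B) (E : bimod B A).

(* F (x)_B E *)
Definition balancing (t : tensor F E) : Prop :=
  exists y b x, t = tpure (ract y b) x - tpure y (lact b x).

Definition btensor : lmodType (Cx R) := quot_mod balancing.

Definition bpure (y : F) (x : E) : btensor := qcls balancing (tpure y x).

(* The map induced by f, on a representative; cf. tlift. *)
Definition blift (V : nmodType) (f : F -> E -> V) (t : btensor) : V :=
  tlift f (repr t).

Lemma bliftE (V : zmodType) (f : F -> E -> V) :
    (forall y y' x, f (y + y') x = f y x + f y' x) ->
    (forall y x x', f y (x + x') = f y x + f y x') ->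
    (forall c y x, f (c *: y) x = f y (c *: x)) ->
    (forall c b (y : F), c *: ract y b = ract (c *: y) b) ->
    (forall y b x, f (ract y b) x = f y (lact b x)) ->
  forall y x, blift f (bpure y x) = f y x.
Proof.
move=> fDl fDr fZ rZ fB y x; rewrite -(tliftE fDl fDr fZ) /blift.
have lD : {morph tlift f : t u / t + u} by exact: (tliftD fDl fDr fZ).
have l0 : tlift f 0 = 0 by apply: (addIr (tlift f 0)); rewrite -lD !add0r.
have lN t : tlift f (- t) = - tlift f t.
  by apply: (addIr (tlift f t)); rewrite -lD !addNr l0.
have [s [sP]] := qrepr balancing (tpure y x).
move/(congr1 (tlift f)); rewrite lD lN => e.
apply/eqP; rewrite -subr_eq0 [_ - _]e; apply/eqP; move: sP {e}.
elim: s => [|[c t] s IH] sP; first by rewrite big_nil l0.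
rewrite big_cons lD IH ?addr0; last first.
  by move=> p ps; apply: sP; rewrite inE ps orbT.
have [y' [b [x' /= ->]]] := sP _ (mem_head _ _).
have cp (u : F) (v : E) : c *: tpure u v = tpure (c *: u) v.
  exact: tscaleE.
rewrite scalerBr !cp lD lN !tliftE //.
by rewrite rZ fB subrr.
Qed.

Definition bt_lact (c : C) : btensor -> btensor :=
  blift (fun y x => bpure (lact c y) x).

Definition bt_ract (t : btensor) (a : A) : btensor :=
  blift (fun y x => bpure y (ract x a)) t.

Definition bt_rip (t t' : btensor) : A :=
  blift (fun y x => blift (fun y' x' => rip x (lact (rip y y') x')) t') t.

Definition bt_lip (t t' : btensor) : C :=
  blift (fun y x => blift (fun y' x' => lip (ract y (lip x x')) y') t') t.

Definition bt_act (g : H) : btensor -> btensor :=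
  blift (fun y x =>
    tlift (fun g1 g2 => bpure (bm_act g1 y) (bm_act g2 x)) (hs_Delta g)).

Definition degenerate (t : btensor) : Prop := forall t', bt_rip t t' = 0.

(* degenerate is itself a submodule, so this is the quotient by it. *)
Definition itensor : lmodType (Cx R) := quot_mod degenerate.

Definition itens_bimod : bimod C A := {|
  bm_car := itensor;
  lact := fun c (q : itensor) => qcls degenerate (bt_lact c (repr q));
  ract := fun (q : itensor) a => qcls degenerate (bt_ract (repr q) a);
  lip := fun q q' : itensor => bt_lip (repr q) (repr q');
  rip := fun q q' : itensor => bt_rip (repr q) (repr q');
  bm_act := fun g (q : itensor) => qcls degenerate (bt_act g (repr q))
|}.

Definition ipure (y : F) (x : E) : itens_bimod := qcls degenerate (bpure y x).

(* The operations of itens_bimod are computed on representatives; this says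
   that they are given by the intended formulas on simple tensors, and that the
   degeneracy spaces of the two inner products agree. *)
Record itens_well_defined : Prop := {
  itens_lact : forall c y x, lact c (ipure y x) = ipure (lact c y) x;
  itens_ract : forall y x a, ract (ipure y x) a = ipure y (ract x a);
  itens_rip : forall y x y' x',
    rip (ipure y x) (ipure y' x') = rip x (lact (rip y y') x');
  itens_lip : forall y x y' x',
    lip (ipure y x) (ipure y' x') = lip (ract y (lip x x')) y';
  itens_act : forall g y x,
    bm_act g (ipure y x)
    = tlift (fun g1 g2 => ipure (bm_act g1 y) (bm_act g2 x)) (hs_Delta g);
  itens_degenerate : forall t,
    (forall t', bt_rip t t' = 0) <-> (forall t', bt_lip t t' = 0)
}.

End TensorBimodule.

(* K is the kind of equivalence bimodule: *- or strong. *)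
Section Picard.
Variable K : forall B A : Hstar_alg H, bimod B A -> Prop.

Definition Kbimod (B A : Hstar_alg H) := {E : bimod B A | K E}.

Definition iso_class (B A : Hstar_alg H) (E : Kbimod B A) : Kbimod B A -> Prop :=
  fun E' => bimod_iso (sval E) (sval E').

Definition Pic (B A : Hstar_alg H) :=
  {X : Kbimod B A -> Prop | exists E, X = iso_class E}.

Definition pic_class (B A : Hstar_alg H) (E : bimod B A) (KE : K E) : Pic B A :=
  exist _ (iso_class (exist _ E KE)) (ex_intro _ (exist _ E KE) erefl).

End Picard.
End Operations.

Record is_groupoid (Ob : Type) (Hom : Ob -> Ob -> Type)
    (comp : forall A B C, Hom B C -> Hom A B -> Hom A C)
    (unit : forall A, Hom A A) (inv : forall A B, Hom A B -> Hom B A) : Prop := {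
  gpd_assoc : forall A B C D (h : Hom C D) (g : Hom B C) (f : Hom A B),
    comp _ _ _ h (comp _ _ _ g f) = comp _ _ _ (comp _ _ _ h g) f;
  gpd_unitl : forall A B (f : Hom A B), comp _ _ _ (unit B) f = f;
  gpd_unitr : forall A B (f : Hom A B), comp _ _ _ f (unit A) = f;
  gpd_invl : forall A B (f : Hom A B), comp _ _ _ (inv _ _ f) f = unit A;
  gpd_invr : forall A B (f : Hom A B), comp _ _ _ f (inv _ _ f) = unit B
}.

(* The classes Pic K B A, as arrows A -> B, form a groupoid with the stated
   composition, units and inverses. *)
Definition is_Picard_groupoid (R : realDomainType) (H : hopf_star_alg R)
    (K : forall B A : Hstar_alg H, bimod B A -> Prop) : Prop :=
  exists (comp : forall A B C, Pic K C B -> Pic K B A -> Pic K C A)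
         (unit : forall A, Pic K A A)
         (inv : forall A B, Pic K B A -> Pic K A B),
    [/\ is_groupoid (Hom := fun A B => Pic K B A) comp unit inv,
        forall A B C (F : bimod C B) (E : bimod B A) (KF : K _ _ F) (KE : K _ _ E),
          itens_well_defined F E /\
          exists KFE : K _ _ (itens_bimod F E),
            comp _ _ _ (pic_class KF) (pic_class KE) = pic_class KFE,
        forall A, exists KA : K _ _ (canonical_bimod A), unit A = pic_class KA
      & forall A B (E : bimod B A) (KE : K _ _ E),
          exists KE' : K _ _ (conj_bimod E),
            inv _ _ (pic_class KE) = pic_class KE'].

(* Main.v *)
Require Import Defs.
From mathcomp Require Import all_boot all_order all_algebra.
From mathcomp Require Import boolp.

Set Implicit Arguments.
Unset Strict Implicit.
Unset Printing Implicit Defensive.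

Import Order.TTheory GRing.Theory Num.Theory.

Local Open Scope ring_scope.

(* Every Sweedler computation reduces to T g = S(g)^*, an involutive antilinear
   algebra map reversing the coproduct.  The compatibility of H with the inner
   product gives <w, g x> = g_(2) <g_(1)^* w, x>; by non-degeneracy this transports
   the covariance g(xa) = (g_(1) x)(g_(2) a) from the algebra to the module, which
   makes the action on tensor products well defined, and it shows that H preserves
   the degeneracy space.  Since bimodules are non-degenerate, an isomorphism is
   determined by, and can be constructed from, a relation between spanning sets
   that preserves both inner products and is compatible with H.  For
   associativity, units and inverses the relations are
   z (x) (y (x) x) ~ (z (x) y) (x) x, b (x) x ~ b x, x (x) a ~ x a, and
   x (x) y ~ <x, y>. *)

(** Covariance of the module actions is not among the axioms of an equivalence bimodule, and
    deriving it uses non-degeneracy. It is thus available for the two factors, but not for their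
    balanced tensor product before the degeneracy space is divided out. This is why the axioms are
    split: [is_pre_equiv] leaves out non-degeneracy, can be verified on the balanced tensor product,
    and still yields the formula that makes the degeneracy space stable under H; one general
    quotient argument then restores non-degeneracy. The degeneracy spaces of the two inner products
    agree because the inner products are full and the algebras non-degenerate. That S reverses
    products and coproducts is not an axiom either; both facts come from the uniqueness of
    convolution inverses. Positivity is defined through functionals, so a positive matrix comes with
    no decomposition into squares to compute with. Complete positivity of a tensor product is
    therefore proved by pulling functionals back. *)

Section AdditiveMaps.
Variables (U V : zmodType) (f : U -> V).
Hypothesis fD : {morph f : x y / x + y}.

Lemma additive_map0 : f 0 = 0.
Proof. by apply: (addIr (f 0)); rewrite -fD !add0r. Qed.

Lemma additive_mapN x : f (- x) = - f x.
Proof. by apply: (addIr (f x)); rewrite -fD !addNr additive_map0. Qed.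

Lemma additive_mapB x y : f (x - y) = f x - f y.
Proof. by rewrite fD additive_mapN. Qed.

Lemma additive_map_sum I (r : seq I) F :
  f (\sum_(i <- r) F i) = \sum_(i <- r) f (F i).
Proof. exact: (big_morph f fD additive_map0). Qed.

End AdditiveMaps.

Section LinearMaps.
Variables (K : pzRingType) (U V : lmodType K) (f : U -> V).
Hypothesis fL : linear f.

Lemma linear_mapD : {morph f : x y / x + y}.
Proof. by move=> x y; have := fL 1 x y; rewrite !scale1r. Qed.

Lemma linear_mapZ c x : f (c *: x) = c *: f x.
Proof. by have := fL c x 0; rewrite !addr0 (additive_map0 linear_mapD) addr0. Qed.

End LinearMaps.

Lemma map_linear (K : pzRingType) (U V : lmodType K) (f : U -> V) :
  {morph f : x y / x + y} -> (forall c x, f (c *: x) = c *: f x) -> linear f.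
Proof. by move=> fD fZ c x y; rewrite fD fZ. Qed.

(** * Spans, quotients, and maps induced on tensor products *)

Section Spans.
Variables (K : pzRingType) (U V : lmodType K).

Lemma in_span_gen (P : U -> Prop) v : P v -> in_span P v.
Proof.
move=> Pv; exists [:: (1, v)]; split; last by rewrite big_seq1 scale1r.
by move=> p; rewrite inE => /eqP ->.
Qed.

Lemma in_span_ind (P Q : U -> Prop) : Q 0 ->
  (forall c u v, P u -> Q v -> Q (c *: u + v)) -> forall v, in_span P v -> Q v.
Proof.
move=> Q0 QD v [s [sP ->]]; elim: s sP => [|p s IH] sP; first by rewrite big_nil.
rewrite big_cons; apply: QD; first by apply: sP; rewrite mem_head.
by apply: IH => q qs; apply: sP; rewrite inE qs orbT.
Qed.

Lemma in_span_sum (P : U -> Prop) I (r : seq I) F :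
  (forall i, in_span P (F i)) -> in_span P (\sum_(i <- r) F i).
Proof.
move=> PF; elim/big_ind: _ => //; [exact: in_span0 | exact: in_spanD].
Qed.

Lemma in_span_trans (P Q : U -> Prop) v :
  (forall u, P u -> in_span Q u) -> in_span P v -> in_span Q v.
Proof.
move=> PQ; elim/in_span_ind => [|c u w Pu Qw]; first exact: in_span0.
by apply: in_spanD Qw; apply: in_spanZ; apply: PQ.
Qed.

(* Semilinearity suffices, so antilinear maps are covered. *)
Lemma in_span_map (P : U -> Prop) (Q : V -> Prop) (f : U -> V) (s : K -> K) v :
  {morph f : x y / x + y} -> (forall c x, f (c *: x) = s c *: f x) ->
  (forall u, P u -> in_span Q (f u)) -> in_span P v -> in_span Q (f v).
Proof.
move=> fD fZ PQ; elim/in_span_ind => [|c u w Pu Qw].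
  by rewrite additive_map0 //; apply: in_span0.
by rewrite fD fZ; apply: in_spanD Qw; apply: in_spanZ; apply: PQ.
Qed.

End Spans.

Section Quotients.
Variables (K : pzRingType) (V : lmodType K) (P : V -> Prop).

Lemma qcls_eq0 v : qcls P v = 0 <-> in_span P v.
Proof. by have := qclsP P v 0; rewrite subr0. Qed.

Lemma qclsZ c v : c *: qcls P v = qcls P (c *: v).
Proof. exact: qscaleE. Qed.

(** All operations on quotients are computed on a chosen representative, and this is how the choice
    is removed. Asking [f] to vanish on multiples of generators, instead of asking for linearity,
    admits maps that are antilinear in this argument. *)
Lemma repr_qcls (W : zmodType) (f : V -> W) v :
  {morph f : x y / x + y} -> (forall c x, P x -> f (c *: x) = 0) ->
  f (repr (qcls P v)) = f v.
Proof.
move=> fD fP; apply/eqP; rewrite -subr_eq0 -(additive_mapB fD); apply/eqP.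
elim/in_span_ind: (qrepr P v) => [|c u w Pu fw]; first exact: additive_map0.
by rewrite fD fP // fw addr0.
Qed.

End Quotients.

Section TensorLift.
Variables (K : comNzRingType) (M N : lmodType K).
Implicit Type V : zmodType.

(* Balanced maps need not be linear, so that Sweedler sums of antilinear
   expressions are covered. *)
Definition balanced2 V (f : M -> N -> V) : Prop :=
  [/\ forall x x' y, f (x + x') y = f x y + f x' y,
      forall x y y', f x (y + y') = f x y + f x y'
    & forall c x y, f (c *: x) y = f x (c *: y)].

Lemma tpureDl (x x' : M) (y : N) : tpure (x + x') y = tpure x y + tpure x' y.
Proof. by rewrite tclsD; apply/tclsP/tens_Dl. Qed.

Lemma tpureDr (x : M) (y y' : N) : tpure x (y + y') = tpure x y + tpure x y'.
Proof. by rewrite tclsD; apply/tclsP/tens_Dr. Qed.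

Lemma tpureZl c (x : M) (y : N) : tpure (c *: x) y = c *: tpure x y.
Proof. by symmetry; exact: tscaleE. Qed.

Lemma tpureZr c (x : M) (y : N) : tpure x (c *: y) = c *: tpure x y.
Proof. by rewrite -tpureZl; apply/tclsP/tens_sym/tens_Z. Qed.

Lemma tclsE (s : seq (M * N)) : tcls s = \sum_(p <- s) tpure p.1 p.2.
Proof.
elim: s => [|[x y] s IH]; first by rewrite big_nil.
by rewrite big_cons -IH tclsD.
Qed.

Lemma tensor_ind (Q : tensor M N -> Prop) : Q 0 ->
  (forall x y t, Q t -> Q (tpure x y + t)) -> forall t, Q t.
Proof.
move=> Q0 QD; elim/tcls_ind=> s; rewrite tclsE.
elim: s => [|p s IH]; first by rewrite big_nil.
by rewrite big_cons; apply: QD.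
Qed.

(** No balancedness is required here or in the next three lemmas: [tlift] is a finite sum over one
    fixed representative, so it can be rewritten, mapped, split and exchanged termwise. Balancedness
    matters only when the tensor itself changes. *)
Lemma eq_tlift V (f h : M -> N -> V) t :
  (forall x y, f x y = h x y) -> tlift f t = tlift h t.
Proof. by move=> fh; apply: eq_bigr => p _. Qed.

Lemma tlift_map (V W : zmodType) (phi : V -> W) (f : M -> N -> V) t :
  {morph phi : x y / x + y} ->
  phi (tlift f t) = tlift (fun x y => phi (f x y)) t.
Proof. by move=> phiD; rewrite /tlift additive_map_sum. Qed.

Lemma tlift_split V (f h : M -> N -> V) t :
  tlift (fun x y => f x y + h x y) t = tlift f t + tlift h t.
Proof. exact: big_split. Qed.

Lemma tlift_exchange (M' N' : lmodType K) V (f : M -> N -> M' -> N' -> V) t t' :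
  tlift (fun x y => tlift (f x y) t') t
  = tlift (fun x' y' => tlift (fun x y => f x y x' y') t) t'.
Proof. exact: exchange_big. Qed.

Section Balanced.
Variables (V : zmodType) (f : M -> N -> V).
Hypothesis fB : balanced2 f.

Lemma tlift_pure x y : tlift f (tpure x y) = f x y.
Proof. by case: fB => fDl fDr fZ; rewrite tliftE. Qed.

Lemma tlift_add t u : tlift f (t + u) = tlift f t + tlift f u.
Proof. by case: fB => fDl fDr fZ; rewrite tliftD. Qed.

(** The scalar stays inside the first argument because [V] is only an additive group: how [c] leaves
    [f] (as itself or conjugated) is decided at each use. *)
Lemma tlift_scale c t : tlift f (c *: t) = tlift (fun x y => f (c *: x) y) t.
Proof.
case: fB => fDl fDr fZ.
have f'Z d x y : f (c *: (d *: x)) y = f (c *: x) (d *: y).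
  by rewrite scalerA mulrC -scalerA fZ.
elim/tensor_ind: t => [|x y t IH].
  rewrite scaler0 (additive_map0 tlift_add); symmetry.
  by apply: additive_map0 => t u; rewrite tliftD // => *; rewrite ?scalerDr ?fDl.
rewrite scalerDr tlift_add IH -tpureZl tlift_pure tliftD ?tliftE // => *;
  by rewrite ?scalerDr ?fDl.
Qed.

End Balanced.

Lemma tlift_tpure (t : tensor M N) : tlift tpure t = t.
Proof.
have B : balanced2 (@tpure K M N).
  by split=> *; rewrite ?tpureDl ?tpureDr ?tpureZl ?tpureZr.
elim/tensor_ind: t => [|x y t IH]; first by rewrite (additive_map0 (tlift_add B)).
by rewrite tlift_add // tlift_pure // IH.
Qed.

End TensorLift.

Arguments balanced2 {K M N V} f.

Section BalancedMaps.
Variables (K : comNzRingType) (M N P Q : lmodType K) (V : zmodType).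

(** Balancedness in neighbouring arguments is what makes [f] factor through the threefold tensor
    product; likewise for [balanced4]. *)
Definition balanced3 (f : M -> N -> P -> V) : Prop :=
  (forall z, balanced2 (fun x y => f x y z)) /\
  (forall x, balanced2 (f x)).

Definition balanced4 (f : M -> N -> P -> Q -> V) : Prop :=
  [/\ forall z w, balanced2 (fun x y => f x y z w),
      forall x w, balanced2 (fun y z => f x y z w)
    & forall x y, balanced2 (fun z w => f x y z w)].

End BalancedMaps.

(** * Sweedler calculus and the antipode *)

Notation "\sw[ a , b <- g ] F" := (tlift (fun a b => F) (hs_Delta g))
  (at level 41, a name, b name, g at level 40, F at level 41,
   right associativity, format "\sw[ a , b  <-  g ]  F").

Section Sweedler.
Variables (R : realDomainType) (H : hopf_star_alg R).
Implicit Types (V W : zmodType) (g h : H).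

Lemma hs_epsD : {morph @hs_eps _ H : g h / g + h}.
Proof. by move=> g h; have := @hs_eps_lin _ H 1 g h; rewrite scale1r mul1r. Qed.

Lemma hs_SD : {morph @hs_S _ H : g h / g + h}.
Proof. exact: (linear_mapD (@hs_S_lin _ H)). Qed.

Lemma hs_SZ c g : hs_S (c *: g) = c *: hs_S g.
Proof. exact: (linear_mapZ (@hs_S_lin _ H)). Qed.

Lemma hs_DeltaD : {morph @hs_Delta _ H : g h / g + h}.
Proof. exact: (linear_mapD (@hs_Delta_lin _ H)). Qed.

Lemma hs_DeltaZ c g : hs_Delta (c *: g) = c *: hs_Delta g.
Proof. exact: (linear_mapZ (@hs_Delta_lin _ H)). Qed.

Section Balanced.
Variables (V : zmodType) (f : H -> H -> V).
Hypothesis fB : balanced2 f.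

Lemma sw_add g h :
  \sw[a, b <- g + h] f a b = \sw[a, b <- g] f a b + \sw[a, b <- h] f a b.
Proof. by rewrite hs_DeltaD tlift_add. Qed.

Lemma sw_scale c g : \sw[a, b <- c *: g] f a b = \sw[a, b <- g] f (c *: a) b.
Proof. by rewrite hs_DeltaZ tlift_scale. Qed.

Lemma sw_1 : \sw[a, b <- 1] f a b = f 1 1.
Proof. by rewrite hs_Delta1 tlift_pure. Qed.

End Balanced.

Lemma sw_coassoc V (f : H -> H -> H -> V) g : balanced3 f ->
  \sw[p, c <- g] \sw[a, b <- p] f a b c = \sw[a, p <- g] \sw[b, c <- p] f a b c.
Proof.
move=> [B12 B23].
(* [phi] is the map induced by [f] on H (x) (H (x) H), where coassociativity is an equation between
   two elements; the two sides of the claim are the values of [phi] at these elements. *)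
pose phi := tlift (fun a (t : tensor H H) => tlift (f a) t).
have phiB : balanced2 (fun a (t : tensor H H) => tlift (f a) t).
  split=> [a a' t|a t t'|c a t].
  - by rewrite -tlift_split; apply: eq_tlift => b d; case: (B12 d) => ->.
  - exact: (tlift_add (B23 a)).
  - rewrite (tlift_scale (B23 a)); apply: eq_tlift => b d.
    by case: (B12 d) => _ _ ->.
have phiD : {morph phi : t u / t + u} := tlift_add phiB.
transitivity (phi (\sw[p, c <- g] \sw[a, b <- p] tpure a (tpure b c))).
  rewrite tlift_map //; apply: eq_tlift => p c; rewrite tlift_map //.
  by apply: eq_tlift => a b; rewrite [RHS]tlift_pure // tlift_pure.
rewrite hs_coassoc tlift_map //; apply: eq_tlift => a p.
exact: (tlift_pure phiB).
Qed.

Section Balanced4.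
Variables (V : zmodType) (f : H -> H -> H -> H -> V).
Hypothesis fB : balanced4 f.

Lemma balanced4_sw_right : balanced3 (fun a b q => \sw[c, d <- q] f a b c d).
Proof.
case: fB => B12 B23 B34; split=> [q|a]; split=> [x x' y|x y y'|k x y];
  rewrite ?sw_add ?sw_scale -?tlift_split //; apply: eq_tlift => c d;
  by [case: (B12 c d) | case: (B23 a d)].
Qed.

Lemma balanced4_sw_middle : balanced3 (fun a q d => \sw[b, c <- q] f a b c d).
Proof.
case: fB => B12 B23 B34; split=> [d|a]; split=> [x x' y|x y y'|k x y];
  rewrite ?sw_add ?sw_scale -?tlift_split //; apply: eq_tlift => b c;
  try by [case: (B12 c d) | case: (B34 a b)].
by case: (B23 a y) => _ _ ->; case: (B34 a b).
Qed.

(** The bracketing on the right isolates the middle pair [b], [c]. It arises when covariance is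
    applied to an outer and then to a nested inner product, and also when a product of neighbours is
    to be cancelled by the antipode. The variant [sw_coassoc4l] peels off the outer legs in the
    other order. *)
Lemma sw_coassoc4r g :
  \sw[p, q <- g] \sw[a, b <- p] \sw[c, d <- q] f a b c d
  = \sw[a, p <- g] \sw[q, d <- p] \sw[b, c <- q] f a b c d.
Proof.
rewrite (sw_coassoc g balanced4_sw_right); apply: eq_tlift => a p.
by rewrite sw_coassoc //; case: fB => B12 B23 B34; split.
Qed.

Lemma sw_coassoc4l g :
  \sw[p, q <- g] \sw[a, b <- p] \sw[c, d <- q] f a b c d
  = \sw[p, d <- g] \sw[a, q <- p] \sw[b, c <- q] f a b c d.
Proof. by rewrite sw_coassoc4r (sw_coassoc g balanced4_sw_middle). Qed.

End Balanced4.

Section Counit.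
Variables (V : zmodType) (phi : H -> V).
Hypothesis phiD : {morph phi : g h / g + h}.

Lemma sw_counitl g : \sw[a, b <- g] phi (hs_eps a *: b) = phi g.
Proof. by rewrite -tlift_map // hs_counitl. Qed.

Lemma sw_counitr g : \sw[a, b <- g] phi (hs_eps b *: a) = phi g.
Proof. by rewrite -tlift_map // hs_counitr. Qed.

Lemma sw_antipodel g : \sw[a, b <- g] phi (hs_S a * b) = phi (hs_eps g *: 1).
Proof. by rewrite -tlift_map // hs_antipodel. Qed.

Lemma sw_antipoder g : \sw[a, b <- g] phi (a * hs_S b) = phi (hs_eps g *: 1).
Proof. by rewrite -tlift_map // hs_antipoder. Qed.

End Counit.

Lemma tpure_mul_balanced (a b : H) :
  balanced2 (fun c d : H => tpure (a * c) (b * d)).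
Proof.
by split=> *; rewrite ?mulrDr -?scalerAr ?tpureDl ?tpureDr ?tpureZl ?tpureZr.
Qed.

Lemma tens_mulDr (t : tensor H H) : {morph tens_mul t : u v / u + v}.
Proof.
move=> u v; rewrite /tens_mul -tlift_split; apply: eq_tlift => a b.
exact: (tlift_add (tpure_mul_balanced a b)).
Qed.

Lemma tens_mul_balanced (u : tensor H H) :
  balanced2 (fun a b : H => tlift (fun c d => tpure (a * c) (b * d)) u).
Proof.
split=> *; rewrite -?tlift_split; apply: eq_tlift => c d;
by rewrite ?mulrDl -?scalerAl ?tpureDl ?tpureDr ?tpureZl ?tpureZr.
Qed.

Lemma tens_mulDl (u : tensor H H) : {morph (@tens_mul _ H)^~ u : t v / t + v}.
Proof. exact: (tlift_add (tens_mul_balanced u)). Qed.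

Lemma tens_mul_pure (a b c d : H) :
  tens_mul (tpure a b) (tpure c d) = tpure (a * c) (b * d).
Proof.
by rewrite /tens_mul tlift_pure ?(tlift_pure (tpure_mul_balanced a b)) //;
  exact: tens_mul_balanced.
Qed.

Lemma tens_mulA : associative (@tens_mul _ H).
Proof.
have m0l u : tens_mul 0 u = 0 := additive_map0 (tens_mulDl u).
have m0r t : tens_mul t 0 = 0 := additive_map0 (tens_mulDr t).
move=> t u v; elim/tensor_ind: t => [|a a' t IHt]; first by rewrite !m0l.
rewrite !tens_mulDl -IHt; congr (_ + _) => {t IHt}.
elim/tensor_ind: u => [|b b' u IHu]; first by rewrite !(m0l, m0r).
rewrite !(tens_mulDl, tens_mulDr) IHu; congr (_ + _) => {u IHu}.
elim/tensor_ind: v => [|c c' v IHv]; first by rewrite !m0r.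
by rewrite !tens_mulDr IHv !tens_mul_pure !mulrA.
Qed.

Lemma tens_mul1l : left_id (tpure 1 1) (@tens_mul _ H).
Proof.
elim/tensor_ind=> [|a b t IH]; first exact: (additive_map0 (tens_mulDr _)).
by rewrite tens_mulDr IH tens_mul_pure !mul1r.
Qed.

Lemma tens_mul1r : right_id (tpure 1 1) (@tens_mul _ H).
Proof.
elim/tensor_ind=> [|a b t IH]; first exact: (additive_map0 (tens_mulDl _)).
by rewrite tens_mulDl IH tens_mul_pure !mulr1.
Qed.

Lemma sw_mul V (f : H -> H -> V) g h : balanced2 f ->
  \sw[a, b <- g * h] f a b
  = \sw[a, b <- g] \sw[c, d <- h] f (a * c) (b * d).
Proof.
move=> fB; have fD := tlift_add fB; rewrite hs_DeltaM /tens_mul tlift_map //.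
apply: eq_tlift => a b; rewrite tlift_map //; apply: eq_tlift => c d.
exact: tlift_pure.
Qed.

Lemma hs_S1 : hs_S 1 = 1 :> H.
Proof.
have := hs_antipodel (1 : H); rewrite sw_1 ?mulr1 ?hs_eps1 ?scale1r //.
by split=> *; rewrite ?hs_SD ?mulrDl ?mulrDr ?hs_SZ -?scalerAl -?scalerAr.
Qed.

(* The map (g, h) |-> S (g h) is a left and (g, h) |-> S h * S g a right
   convolution inverse of the multiplication. *)
Lemma hs_SM g h : hs_S (g * h) = hs_S h * hs_S g.
Proof.
pose F a b c x y z : H := hs_S (a * x) * (b * y) * (hs_S z * hs_S c).
have FE := (hs_SD, hs_SZ, mulrDl, mulrDr).
have FB a b c : balanced3 (F a b c).
  by split=> ?; split=> *; rewrite /F ?FE -?(scalerAl, scalerAr) ?hs_SZ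
    -?(scalerAl, scalerAr).
have GB : balanced3 (fun a b c => \sw[q, z <- h] \sw[x, y <- q] F a b c x y z).
  split=> ?; split=> *; rewrite -?tlift_split; apply: eq_tlift => q z;
    rewrite -?tlift_split; apply: eq_tlift => x y;
    by rewrite /F ?FE -?(scalerAl, scalerAr) ?hs_SZ -?(scalerAl, scalerAr).
have := sw_coassoc g GB.
(* Bracketed to the left, [hs_S (a * x) * (b * y)] is an antipode sum over [p * q], so only counits
   remain in front of [hs_S z * hs_S c]. *)
have -> : \sw[p, c <- g] \sw[a, b <- p] \sw[q, z <- h] \sw[x, y <- q] F a b c x y z
    = hs_S h * hs_S g.
  rewrite -[hs_S g](sw_counitl hs_SD) tlift_map; last exact: mulrDr.
  apply: eq_tlift => p c; rewrite tlift_exchange.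
  rewrite -[hs_S h](sw_counitl hs_SD) (tlift_map _ _ (fun x y => mulrDl x y _)).
  apply: eq_tlift => q z.
  pose phi w := w * (hs_S z * hs_S c).
  have phiD : {morph phi : u v / u + v} by move=> u v; rewrite /phi mulrDl.
  rewrite -(@sw_mul _ (fun u v => phi (hs_S u * v))); last first.
    by split=> *; rewrite ?FE ?phiD // -!(scalerAl, scalerAr).
  rewrite sw_antipodel // /phi hs_epsM !hs_SZ -!(scalerAl, scalerAr).
  by rewrite mul1r !scalerA mulrC.
move=> ->.
(* Bracketed to the right, [y * hs_S z] cancels first, since it stands between [b] and [hs_S c];
   then [b * hs_S c] cancels, and [hs_S (a * x)] is what is left. *)
under eq_tlift => a p do under eq_tlift => b c do rewrite sw_coassoc //.
have SD k : {morph (fun x : H => hs_S (k * x)) : u v / u + v}.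
  by move=> u v; rewrite mulrDr hs_SD.
have SD' k : {morph (fun x : H => hs_S (x * k)) : u v / u + v}.
  by move=> u v; rewrite mulrDl hs_SD.
rewrite -(sw_counitr (SD' h)); apply: eq_tlift => a p.
rewrite tlift_exchange -(sw_counitr (SD _)); apply: eq_tlift => x q; symmetry.
have D1 b c : {morph (fun u => hs_S (a * x) * (b * u * hs_S c)) : u v / u + v}.
  by move=> u v; rewrite ?FE.
transitivity (\sw[b, c <- p] hs_S (a * x) * (b * (hs_eps q *: 1) * hs_S c)).
  apply: eq_tlift => b c; rewrite -(sw_antipoder (D1 b c) q).
  by apply: eq_tlift => y z; rewrite /F !mulrA.
have D2 : {morph (fun u => hs_eps q *: (hs_S (a * x) * u)) : u v / u + v}.
  by move=> u v; rewrite mulrDr scalerDr.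
transitivity (\sw[b, c <- p] hs_eps q *: (hs_S (a * x) * (b * hs_S c))).
  by apply: eq_tlift => b c; rewrite -!(scalerAl, scalerAr) mulr1.
rewrite (sw_antipoder D2) -!(scalerAl, scalerAr) !hs_SZ mulr1 !scalerA.
by rewrite mulrC.
Qed.

(** In the convolution algebra of maps from H to H (x) H, the left-hand side is a left inverse of
    the coproduct ([LD] below) and the right-hand side [N] is a right inverse ([DN]). Bracketing the
    triple product [F] in both ways identifies them. *)
Lemma hs_Delta_S g : hs_Delta (hs_S g) = \sw[a, b <- g] tpure (hs_S b) (hs_S a).
Proof.
have FE := (hs_DeltaD, hs_DeltaZ, hs_SD, hs_SZ, tpureDl, tpureDr, tpureZl, tpureZr).
have mD := (@tens_mulDl, @tens_mulDr).
have mZl c (t u : tensor H H) : tens_mul (c *: t) u = c *: tens_mul t u.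
  elim/tensor_ind: u => [|x y u IH].
    by rewrite !(additive_map0 (tens_mulDr _)) scaler0.
  rewrite !tens_mulDr IH scalerDr; congr (_ + _) => {u IH}.
  elim/tensor_ind: t => [|x' y' u IH].
    by rewrite scaler0 !(additive_map0 (tens_mulDl _)) scaler0.
  rewrite scalerDr !tens_mulDl IH scalerDr; congr (_ + _) => {u IH}.
  by rewrite -tpureZl !tens_mul_pure -scalerAl tpureZl.
have mZr c (t u : tensor H H) : tens_mul t (c *: u) = c *: tens_mul t u.
  elim/tensor_ind: u => [|x y u IH].
    by rewrite scaler0 !(additive_map0 (tens_mulDr _)) scaler0.
  rewrite scalerDr !tens_mulDr IH scalerDr; congr (_ + _) => {u IH}.
  elim/tensor_ind: t => [|x' y' u IH].
    by rewrite !(additive_map0 (tens_mulDl _)) scaler0.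
  rewrite !tens_mulDl IH scalerDr; congr (_ + _) => {u IH}.
  by rewrite -tpureZl !tens_mul_pure -scalerAr tpureZl.
pose N (c : H) := \sw[a, b <- c] tpure (hs_S b) (hs_S a).
have NB : balanced2 (fun a b : H => tpure (hs_S b) (hs_S a)).
  by split=> *; rewrite ?FE.
have ND c d : N (c + d) = N c + N d by rewrite /N sw_add.
have NZ k c : N (k *: c) = k *: N c.
  rewrite /N sw_scale // (tlift_map _ _ (scalerDr k)).
  by apply: eq_tlift => a b; rewrite ?FE.
pose F (a b c : H) := tens_mul (tens_mul (hs_Delta (hs_S a)) (hs_Delta b)) (N c).
have FB : balanced3 F.
  by split=> ?; split=> *; rewrite /F ?(FE, mD, ND) -?(mZl, mZr) //
    ?(FE, NZ, mZl, mZr).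
have DN q : \sw[b, c <- q] tens_mul (hs_Delta b) (N c)
    = hs_eps q *: tpure (1 : H) (1 : H).
  transitivity (\sw[b, c <- q] \sw[x, y <- b] \sw[u, v <- c]
      tpure (x * hs_S v) (y * hs_S u)).
    apply: eq_tlift => b c; rewrite -[X in tens_mul X _]tlift_tpure.
    rewrite (tlift_map _ _ (fun t u => tens_mulDl (N c) t u)).
    apply: eq_tlift => x y; rewrite (tlift_map _ _ (tens_mulDr _)).
    by apply: eq_tlift => u v; rewrite tens_mul_pure.
  (* In the order [x], [y], [u], [v] the middle pair meets in the second leg as [y * hs_S u] and
     cancels; this makes [x] and [v] neighbours, which then cancel in the first leg. *)
  rewrite sw_coassoc4r; last first.
    by split=> ? ?; split=> *;
      rewrite ?(mulrDl, mulrDr, FE) -?(scalerAl, scalerAr) ?(mulrDl, mulrDr, FE)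
        -?(scalerAl, scalerAr) ?FE.
  transitivity (\sw[x, p <- q] tpure (x * hs_S p) (1 : H)).
    apply: eq_tlift => x p.
    have phiD : {morph (fun w => tpure (x * hs_S w) (1 : H)) : u v / u + v}.
      by move=> u v; rewrite ?FE mulrDr tpureDl.
    rewrite -(sw_counitl phiD); apply: eq_tlift => r v.
    have psiD : {morph (fun w : H => tpure (x * hs_S v) w) : u v / u + v}.
      by move=> u' v'; rewrite tpureDr.
    by rewrite (sw_antipoder psiD) ?FE -scalerAr ?FE.
  have psiD : {morph (fun w : H => tpure w (1 : H)) : u v / u + v}.
    by move=> u' v'; rewrite tpureDl.
  by rewrite (sw_antipoder psiD) ?FE.
have LD q : \sw[a, b <- q] tens_mul (hs_Delta (hs_S a)) (hs_Delta b)
    = hs_eps q *: tpure (1 : H) (1 : H).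
  transitivity (\sw[a, b <- q] hs_Delta (hs_S a * b)).
    by apply: eq_tlift => a b; rewrite hs_DeltaM.
  by rewrite (sw_antipodel hs_DeltaD) hs_DeltaZ hs_Delta1.
have DSD : {morph (fun w : H => hs_Delta (hs_S w)) : u v / u + v}.
  by move=> u v; rewrite ?FE.
rewrite -(sw_counitr DSD) -[RHS](sw_counitl ND).
transitivity (\sw[a, q <- g] \sw[b, c <- q] F a b c).
  apply: eq_tlift => a q.
  under [RHS]eq_tlift => b c do rewrite /F -tens_mulA.
  by rewrite -(tlift_map _ _ (tens_mulDr _)) DN mZr tens_mul1r ?FE.
rewrite -sw_coassoc //; apply: eq_tlift => q c.
by rewrite -(tlift_map _ _ (fun t u => tens_mulDl (N c) t u)) LD mZl tens_mul1l NZ.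
Qed.

Definition starS g : H := hs_star (hs_S g).

Lemma starSD : {morph starS : g h / g + h}.
Proof. by move=> g h; rewrite /starS hs_SD hs_starD. Qed.

Lemma starSZ c g : starS (c *: g) = cconj c *: starS g.
Proof. by rewrite /starS hs_SZ hs_starZ. Qed.

Lemma starSM g h : starS (g * h) = starS g * starS h.
Proof. by rewrite /starS hs_SM hs_starM. Qed.

Lemma hs_star1 : hs_star 1 = 1 :> H.
Proof. by rewrite -[LHS]mulr1 -[X in _ * X]hs_starK -hs_starM mulr1 hs_starK. Qed.

Lemma starS1 : starS 1 = 1.
Proof. by rewrite /starS hs_S1 hs_star1. Qed.

(** The flip of the legs comes from S alone, the star acting on each leg separately. It supplies the
    order of the factors that covariance of the inner products on a tensor product requires. *)
Lemma sw_starS V (f : H -> H -> V) g : balanced2 f ->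
  \sw[a, b <- starS g] f a b = \sw[a, b <- g] f (starS b) (starS a).
Proof.
move=> fB; have fD := tlift_add fB; rewrite /starS hs_Delta_star hs_Delta_S.
have B : balanced2 (fun a b : H => tpure (hs_star a) (hs_star b)).
  by split=> *; rewrite ?hs_starD ?hs_starZ ?tpureDl ?tpureDr ?tpureZl ?tpureZr.
rewrite (tlift_map _ _ (tlift_add B)) tlift_map //; apply: eq_tlift => a b.
by rewrite (tlift_pure B) tlift_pure.
Qed.

(** The star of the right antipode law, as [starS b * hs_star a] is the star of [a * hs_S b]. This
    is the cancellation behind [rip_bm_act]. *)
Lemma sw_starS_mul V (phi : H -> V) g : {morph phi : g h / g + h} ->
  \sw[a, b <- g] phi (starS b * hs_star a) = phi (cconj (hs_eps g) *: 1).
Proof.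
move=> phiD; under eq_tlift => a b do rewrite /starS -hs_starM.
rewrite (sw_antipoder (phi := phi \o @hs_star _ H)) /=; last first.
  by move=> u v /=; rewrite hs_starD phiD.
by rewrite hs_starZ hs_star1.
Qed.

End Sweedler.

(** * Bimodules with possibly degenerate inner products *)

Section Algebras.
Variables (R : realDomainType) (H : hopf_star_alg R).

Lemma sa_mulZl (A : star_alg R) c (a b : A) : sa_mul (c *: a) b = c *: sa_mul a b.
Proof. exact: (linear_mapZ (sa_mul_linl b)). Qed.

Lemma sa_mulZr (A : star_alg R) c (a b : A) : sa_mul a (c *: b) = c *: sa_mul a b.
Proof. exact: (linear_mapZ (sa_mul_linr a)). Qed.

Variable A : Hstar_alg H.

Lemma ha_actDr g : {morph @ha_act _ _ A g : a b / a + b}.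
Proof. exact: linear_mapD (Hmod_linr (sact_Hmodule (ha_actP A)) g). Qed.

Lemma ha_actZr g c (a : A) : ha_act g (c *: a) = c *: ha_act g a.
Proof. exact: linear_mapZ (Hmod_linr (sact_Hmodule (ha_actP A)) g) c a. Qed.

Lemma ha_actDl g h (a : A) : ha_act (g + h) a = ha_act g a + ha_act h a.
Proof. exact: linear_mapD (Hmod_linl (sact_Hmodule (ha_actP A)) a) g h. Qed.

Lemma ha_actZl c g (a : A) : ha_act (c *: g) a = c *: ha_act g a.
Proof. exact: linear_mapZ (Hmod_linl (sact_Hmodule (ha_actP A)) a) c g. Qed.

Lemma ha_act_mul g (a b : A) :
  ha_act g (sa_mul a b) = \sw[g1, g2 <- g] sa_mul (ha_act g1 a) (ha_act g2 b).
Proof. exact: sact_mul (ha_actP A) g a b. Qed.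

End Algebras.

Section PreEquivalence.
Variables (R : realDomainType) (H : hopf_star_alg R).

(* The axioms of an equivalence bimodule except non-degeneracy. *)
Record is_pre_equiv (B A : Hstar_alg H) (E : bimod B A) : Prop := PreEquiv {
  pre_lact_linl : forall x, linear (fun b => lact b x : E);
  pre_lact_linr : forall b, linear (fun x : E => lact b x);
  pre_lactA : forall b b' (x : E), lact (sa_mul b b') x = lact b (lact b' x);
  pre_ract_linl : forall a, linear (fun x : E => ract x a);
  pre_ract_linr : forall x, linear (fun a => ract x a : E);
  pre_ractA : forall (x : E) a a', ract x (sa_mul a a') = ract (ract x a) a';
  pre_lract : forall b (x : E) a, ract (lact b x) a = lact b (ract x a);
  pre_lact_spans : spans (fun z : E => exists b x, z = lact b x);
  pre_ract_spans : spans (fun z : E => exists x a, z = ract x a);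
  pre_rip_lin : forall x, linear (fun y : E => rip x y);
  pre_rip_sym : forall x y : E, rip x y = sa_star (rip y x);
  pre_rip_ract : forall (x y : E) a, rip x (ract y a) = sa_mul (rip x y) a;
  pre_rip_full : spans (fun a : A => exists x y : E, a = rip x y);
  pre_lip_lin : forall y, linear (fun x : E => lip x y);
  pre_lip_sym : forall x y : E, lip x y = sa_star (lip y x);
  pre_lip_lact : forall b (x y : E), lip (lact b x) y = sa_mul b (lip x y);
  pre_lip_full : spans (fun b : B => exists x y : E, b = lip x y);
  pre_rip_lact : forall b (x y : E), rip (lact b x) y = rip x (lact (sa_star b) y);
  pre_lip_ract : forall (x y : E) a, lip (ract x a) y = lip x (ract y (sa_star a));
  pre_lip_rip : forall x y z : E, lact (lip x y) z = ract x (rip y z);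
  pre_Hmodule : is_Hmodule (@bm_act _ _ _ _ E);
  pre_act_rip : forall g (x y : E),
    ha_act g (rip x y)
    = \sw[g1, g2 <- g] rip (bm_act (starS g1) x) (bm_act g2 y);
  pre_act_lip : forall g (x y : E),
    ha_act g (lip x y)
    = \sw[g1, g2 <- g] lip (bm_act g1 x) (bm_act (starS g2) y)
}.

Lemma equiv_pre (B A : Hstar_alg H) (E : bimod B A) :
  is_equiv_bimod E -> is_pre_equiv E.
Proof. by case=> *; split. Qed.

Section Rules.
Variables (B A : Hstar_alg H) (E : bimod B A) (PE : is_pre_equiv E).
Implicit Types (x y z w : E) (b : B) (a : A) (g h : H).

Lemma lactDl b b' x : lact (b + b') x = lact b x + lact b' x.
Proof. exact: linear_mapD (pre_lact_linl PE x) b b'. Qed.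

Lemma lactZl c b x : lact (c *: b) x = c *: lact b x.
Proof. exact: linear_mapZ (pre_lact_linl PE x) c b. Qed.

Lemma lactDr b : {morph lact b : x y / x + y : E}.
Proof. exact: linear_mapD (pre_lact_linr PE b). Qed.

Lemma lactZr c b x : lact b (c *: x) = c *: lact b x.
Proof. exact: linear_mapZ (pre_lact_linr PE b) c x. Qed.

Lemma ractDl a : {morph (fun x : E => ract x a) : x y / x + y}.
Proof. exact: linear_mapD (pre_ract_linl PE a). Qed.

Lemma ractZl c x a : ract (c *: x) a = c *: ract x a.
Proof. exact: linear_mapZ (pre_ract_linl PE a) c x. Qed.

Lemma ractDr x a a' : ract x (a + a') = ract x a + ract x a'.
Proof. exact: linear_mapD (pre_ract_linr PE x) a a'. Qed.

Lemma ractZr c x a : ract x (c *: a) = c *: ract x a.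
Proof. exact: linear_mapZ (pre_ract_linr PE x) c a. Qed.

Lemma ripDr x : {morph rip x : y z / y + z : E >-> y + z}.
Proof. exact: linear_mapD (pre_rip_lin PE x). Qed.

Lemma ripZr c x y : rip x (c *: y) = c *: rip x y.
Proof. exact: linear_mapZ (pre_rip_lin PE x) c y. Qed.

Lemma ripDl y : {morph (fun x : E => rip x y) : x z / x + z}.
Proof. by move=> x z; rewrite !(pre_rip_sym PE _ y) ripDr sa_starD. Qed.

Lemma ripZl c x y : rip (c *: x) y = cconj c *: rip x y.
Proof. by rewrite !(pre_rip_sym PE _ y) ripZr sa_starZ. Qed.

Lemma lipDl y : {morph (fun x : E => lip x y) : x z / x + z}.
Proof. exact: linear_mapD (pre_lip_lin PE y). Qed.

Lemma lipZl c x y : lip (c *: x) y = c *: lip x y.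
Proof. exact: linear_mapZ (pre_lip_lin PE y) c x. Qed.

Lemma lipDr x : {morph lip x : y z / y + z : E >-> y + z}.
Proof. by move=> y z; rewrite !(pre_lip_sym PE x) lipDl sa_starD. Qed.

Lemma lipZr c x y : lip x (c *: y) = cconj c *: lip x y.
Proof. by rewrite !(pre_lip_sym PE x) lipZl sa_starZ. Qed.

Lemma bm_actDr g : {morph bm_act g : x y / x + y : E}.
Proof. exact: linear_mapD (Hmod_linr (pre_Hmodule PE) g). Qed.

Lemma bm_actZr c g x : bm_act g (c *: x) = c *: bm_act g x.
Proof. exact: linear_mapZ (Hmod_linr (pre_Hmodule PE) g) c x. Qed.

Lemma bm_actDl g h x : bm_act (g + h) x = bm_act g x + bm_act h x.
Proof. exact: linear_mapD (Hmod_linl (pre_Hmodule PE) x) g h. Qed.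

Lemma bm_actZl c g x : bm_act (c *: g) x = c *: bm_act g x.
Proof. exact: linear_mapZ (Hmod_linl (pre_Hmodule PE) x) c g. Qed.

Lemma bm_act1 x : bm_act 1 x = x.
Proof. exact: Hmod_1 (pre_Hmodule PE) x. Qed.

Lemma bm_actM g h x : bm_act (g * h) x = bm_act g (bm_act h x).
Proof. exact: Hmod_M (pre_Hmodule PE) g h x. Qed.

Lemma lip_ractr x y a : lip x (ract y a) = lip (ract x (sa_star a)) y.
Proof. by rewrite (pre_lip_ract PE) sa_starK. Qed.

Lemma rip_lactr x y b : rip x (lact b y) = rip (lact (sa_star b) x) y.
Proof. by rewrite (pre_rip_lact PE) sa_starK. Qed.

Lemma rip_ractl x y a : rip (ract x a) y = sa_mul (sa_star a) (rip x y).
Proof. by rewrite (pre_rip_sym PE) (pre_rip_ract PE) sa_starM -(pre_rip_sym PE). Qed.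

Lemma lip_lactr x y b : lip x (lact b y) = sa_mul (lip x y) (sa_star b).
Proof. by rewrite (pre_lip_sym PE) (pre_lip_lact PE) sa_starM -(pre_lip_sym PE). Qed.

(* Expressing h |-> rip w (h x) through the action on A transports identities
   from A to E. *)
Lemma rip_bm_act w g z :
  rip w (bm_act g z) = \sw[g1, g2 <- g] ha_act g2 (rip (bm_act (hs_star g1) w) z).
Proof.
have phiD : {morph (fun u : H => rip w (bm_act u z)) : u v / u + v}.
  by move=> u v; rewrite bm_actDl ripDr.
rewrite -(sw_counitl phiD); symmetry.
(* The right-hand side is expanded by covariance of the inner product. After regrouping, [w] is
   acted on by [starS g2 * hs_star g1], which sums to a conjugated counit; moving it out of the
   antilinear argument undoes the conjugation. *)
transitivity (\sw[g1, p <- g] \sw[g2, g3 <- p]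
    rip (bm_act (starS g2) (bm_act (hs_star g1) w)) (bm_act g3 z)).
  by apply: eq_tlift => g1 p; rewrite (pre_act_rip PE).
rewrite -(@sw_coassoc _ _ _ (fun g1 g2 g3 =>
    rip (bm_act (starS g2) (bm_act (hs_star g1) w)) (bm_act g3 z))); last first.
  split=> ?; split=> *;
    rewrite ?(starSD, hs_starD, bm_actDl, bm_actDr) ?(ripDl, ripDr) //;
    by rewrite ?(starSZ, hs_starZ, bm_actZl, bm_actZr) ?(ripZl, ripZr, cconjK).
apply: eq_tlift => p g3.
pose psi u := rip (bm_act u w) (bm_act g3 z).
have psiD : {morph psi : u v / u + v}.
  by move=> u v; rewrite /psi bm_actDl ripDl.
transitivity (\sw[g1, g2 <- p] psi (starS g2 * hs_star g1)).
  by apply: eq_tlift => g1 g2; rewrite /psi bm_actM.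
by rewrite (sw_starS_mul _ psiD) /psi !bm_actZl bm_act1 ripZl ripZr cconjK.
Qed.

End Rules.
End PreEquivalence.

(** * Covariance of the two module actions *)

Section Covariance.
Variables (R : realDomainType) (H : hopf_star_alg R).
Variables (B A : Hstar_alg H) (E : bimod B A) (EE : is_equiv_bimod E).
Let PE := equiv_pre EE.

Lemma rip_ext (x y : E) : (forall w, rip w x = rip w y) -> x = y.
Proof.
move=> xy; apply/eqP; rewrite -subr_eq0; apply/eqP; apply: (rip_nondeg EE) => w.
rewrite (pre_rip_sym PE) (additive_mapB (ripDr PE w)) xy subrr.
exact: sa_star0.
Qed.

Lemma lip_ext (x y : E) : (forall w, lip x w = lip y w) -> x = y.
Proof.
move=> xy; apply/eqP; rewrite -subr_eq0; apply/eqP; apply: (lip_nondeg EE) => w.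
by rewrite (additive_mapB (lipDl PE w)) xy subrr.
Qed.

Lemma bm_act_ract g (x : E) a :
  bm_act g (ract x a) = \sw[g1, g2 <- g] ract (bm_act g1 x) (ha_act g2 a).
Proof.
apply: rip_ext => w; rewrite (rip_bm_act PE) (tlift_map _ _ (ripDr PE w)).
pose F g1 g2 g3 :=
  sa_mul (ha_act g2 (rip (bm_act (hs_star g1) w) x)) (ha_act g3 a).
transitivity (\sw[g1, p <- g] \sw[g2, g3 <- p] F g1 g2 g3).
  by apply: eq_tlift => g1 p; rewrite (pre_rip_ract PE) ha_act_mul.
rewrite -sw_coassoc; last first.
  split=> ?; split=> *; rewrite /F ?hs_starD ?(bm_actDl PE) ?(ripDl PE)
    ?ha_actDr ?ha_actDl ?sa_mulDl ?sa_mulDr // ?hs_starZ ?(bm_actZl PE)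
    ?(ripZl PE) ?cconjK ?(ha_actZl, ha_actZr) ?(sa_mulZl, sa_mulZr) //.
apply: eq_tlift => p g3; rewrite (pre_rip_ract PE) (rip_bm_act PE).
by rewrite (tlift_map _ _ (fun u v => sa_mulDl u v _)).
Qed.

(** By fullness it suffices to take [b] of the form [lip y z]. Then b x equals y <z, x>, so the
    claim follows from covariance of the right action together with covariance of both inner
    products. *)
Lemma bm_act_lact g b (x : E) :
  bm_act g (lact b x) = \sw[g1, g2 <- g] lact (ha_act g1 b) (bm_act g2 x).
Proof.
have fD : {morph (fun b => bm_act g (lact b x)) : b b' / b + b'}.
  by move=> b1 b2; rewrite (lactDl PE) (bm_actDr PE).
have hD : {morph (fun b => \sw[g1, g2 <- g] lact (ha_act g1 b) (bm_act g2 x)) :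
    b b' / b + b'}.
  move=> b1 b2; rewrite -tlift_split; apply: eq_tlift => g1 g2.
  by rewrite ha_actDr (lactDl PE).
elim/in_span_ind: (lip_full EE b) => [|c _ b' [y [z ->]] IH].
  by rewrite (additive_map0 fD) (additive_map0 hD).
rewrite fD hD IH; congr (_ + _); rewrite -(lipZl PE).
move: (c *: y) => {}y; rewrite (pre_lip_rip PE) bm_act_ract.
pose F g1 g2 g3 : E :=
  ract (bm_act g1 y) (rip (bm_act (starS g2) z) (bm_act g3 x)).
transitivity (\sw[g1, p <- g] \sw[g2, g3 <- p] F g1 g2 g3).
  apply: eq_tlift => g1 p; rewrite (pre_act_rip PE) tlift_map //.
  exact: (ractDr PE).
rewrite -sw_coassoc; last first.
  split=> ?; split=> *; rewrite /F ?starSD ?(bm_actDl PE) ?(ripDl PE) ?(ripDr PE)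
    ?(ractDl PE) ?(ractDr PE) // ?starSZ ?(bm_actZl PE)
    ?(ripZl PE) ?(ripZr PE) ?cconjK ?(ractZl PE) ?(ractZr PE) //.
apply: eq_tlift => p g3.
rewrite (pre_act_lip PE) (tlift_map _ _ (fun u v => lactDl PE u v _)).
by apply: eq_tlift => g1 g2; rewrite /F (pre_lip_rip PE).
Qed.

End Covariance.

(** * Dividing out the degeneracy space *)

Section Quotient.
Variables (R : realDomainType) (H : hopf_star_alg R).
Variables (B A : Hstar_alg H) (E : bimod B A) (PE : is_pre_equiv E).

Definition null (x : E) : Prop := forall y, rip x y = 0.

Lemma in_span_null x : in_span null x -> null x.
Proof.
elim/in_span_ind => [|c u v nu nv] y; first exact: (additive_map0 (ripDl PE y)).
by rewrite (ripDl PE) (ripZl PE) nu nv scaler0 addr0.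
Qed.

Lemma null_ripr x y : null x -> rip y x = 0.
Proof. by move=> nx; rewrite (pre_rip_sym PE) nx sa_star0. Qed.

(** If [x] is null for [rip], then [lip z w] times [lip x y] is the [lip] of z <w, x> and [y], hence
    0. The elements [lip z w] span B, so [lip x y] is annihilated by all of B and vanishes since B
    is non-degenerate. The converse is the mirror image in A. *)
Lemma nullP x : null x <-> forall y, lip x y = 0.
Proof.
have nA := ha_nondeg A; have nB := ha_nondeg B.
split=> [nx y|nx y].
  apply: nB.2 => b; elim/in_span_ind: (pre_lip_full PE b) => [|c _ b' [z [w ->]] IH].
    exact: sa_mul0l.
  rewrite sa_mulDl IH sa_mulZl -(pre_lip_lact PE) (pre_lip_rip PE) null_ripr //.
  rewrite (additive_map0 (fun a a' => ractDr PE z a a')).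
  by rewrite (additive_map0 (lipDl PE y)) scaler0 addr0.
apply: nA.2 => a; elim/in_span_ind: (pre_rip_full PE a) => [|c _ a' [z [w ->]] IH].
  exact: sa_mul0l.
rewrite sa_mulDl IH sa_mulZl -(pre_rip_ract PE) -(pre_lip_rip PE).
rewrite (pre_lip_sym PE) nx sa_star0 (additive_map0 (fun b b' => lactDl PE b b' y)).
by rewrite (additive_map0 (ripDr PE z)) scaler0 addr0.
Qed.

Lemma nullZ c x : null x -> null (c *: x).
Proof. by move=> nx y; rewrite (ripZl PE) nx scaler0. Qed.

Lemma null_lact b x : null x -> null (lact b x).
Proof. by move=> nx y; rewrite (pre_rip_lact PE). Qed.

Lemma null_ract a x : null x -> null (ract x a).
Proof. by move=> nx y; rewrite (rip_ractl PE) nx sa_mul0r. Qed.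

Lemma null_act g x : null x -> null (bm_act g x).
Proof.
move=> nx y; rewrite (pre_rip_sym PE) (rip_bm_act PE) /tlift big1 ?sa_star0 //.
by move=> p _; rewrite null_ripr // (additive_map0 (ha_actDr _)).
Qed.

Lemma qcls_null x : qcls null x = 0 <-> null x.
Proof. by split=> [/qcls_eq0/in_span_null|nx] //; apply/qcls_eq0/in_span_gen. Qed.

(** Written on representatives in the same form as [itens_bimod]: for the balanced tensor product
    [bt_bimod] the two are convertible, which is how the results of this section are transferred. *)
Definition quot_bimod : bimod B A := {|
  bm_car := quot_mod null;
  lact := fun b (q : quot_mod null) => qcls null (lact b (repr q));
  ract := fun (q : quot_mod null) a => qcls null (ract (repr q) a);
  lip := fun q q' : quot_mod null => lip (repr q) (repr q');
  rip := fun q q' : quot_mod null => rip (repr q) (repr q');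
  bm_act := fun g (q : quot_mod null) => qcls null (bm_act g (repr q))
|}.

Definition qmap (x : E) : quot_bimod := qcls null x.

Lemma qmapD : {morph qmap : x y / x + y}.
Proof. by move=> x y; rewrite /qmap qclsD. Qed.

Lemma qmapZ c x : qmap (c *: x) = c *: qmap x.
Proof. by rewrite /qmap qclsZ. Qed.

Lemma qmap_ind (Q : quot_bimod -> Prop) : (forall x, Q (qmap x)) -> forall q, Q q.
Proof. exact: qind. Qed.

Lemma qmap_repr (W : zmodType) (f : E -> W) x :
  {morph f : x y / x + y} -> (forall x, null x -> f x = 0) ->
  f (repr (qmap x)) = f x.
Proof. by move=> fD f0; apply: repr_qcls => // c y ny; apply/f0/nullZ. Qed.

Lemma lact_qmap b x : lact b (qmap x) = qmap (lact b x).
Proof.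
apply: (@qmap_repr _ (fun x => qmap (lact b x))) => [y z|y ny].
  by rewrite (lactDr PE) qmapD.
exact/qcls_null/null_lact.
Qed.

Lemma ract_qmap x a : ract (qmap x) a = qmap (ract x a).
Proof.
apply: (@qmap_repr _ (fun x => qmap (ract x a))) => [y z|y ny].
  by rewrite (ractDl PE) qmapD.
exact/qcls_null/null_ract.
Qed.

Lemma bm_act_qmap g x : bm_act g (qmap x) = qmap (bm_act g x).
Proof.
apply: (@qmap_repr _ (fun x => qmap (bm_act g x))) => [y z|y ny].
  by rewrite (bm_actDr PE) qmapD.
exact/qcls_null/null_act.
Qed.

Lemma rip_qmap x y : rip (qmap x) (qmap y) = rip x y.
Proof.
rewrite [LHS](@qmap_repr _ (fun x => rip x (repr (qmap y)))).
- by apply: qmap_repr => [|z]; [exact: (ripDr PE) | exact: null_ripr].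
- exact: (ripDl PE).
- by move=> z nz.
Qed.

Lemma lip_qmap x y : lip (qmap x) (qmap y) = lip x y.
Proof.
rewrite [LHS](@qmap_repr _ (fun x => lip x (repr (qmap y)))).
- apply: qmap_repr => [|z nz]; first exact: (lipDr PE).
  by rewrite (pre_lip_sym PE) (nullP z).1 // sa_star0.
- exact: (lipDl PE).
- by move=> z /nullP.
Qed.

Lemma spans_qmap (P : E -> Prop) (Q : quot_bimod -> Prop) :
  (forall x, P x -> Q (qmap x)) -> spans P -> spans Q.
Proof.
move=> PQ sP; elim/qmap_ind=> x.
apply: (in_span_map qmapD qmapZ _ (sP x)) => y Py.
exact/in_span_gen/PQ.
Qed.

Lemma quot_equiv_bimod : is_equiv_bimod quot_bimod.
Proof.
have qE := (lact_qmap, ract_qmap, bm_act_qmap, rip_qmap, lip_qmap).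
have qDZ x y c : c *: qmap x + qmap y = qmap (c *: x + y) by rewrite qmapD qmapZ.
split.
- elim/qmap_ind=> x c b b'; by rewrite !qE qDZ (pre_lact_linl PE).
- move=> b c; elim/qmap_ind=> x; elim/qmap_ind=> y.
  by rewrite qDZ !qE qDZ (pre_lact_linr PE).
- by move=> b b'; elim/qmap_ind=> x; rewrite !qE (pre_lactA PE).
- move=> a c; elim/qmap_ind=> x; elim/qmap_ind=> y.
  by rewrite qDZ !qE qDZ (pre_ract_linl PE).
- by elim/qmap_ind=> x c a a'; rewrite !qE qDZ (pre_ract_linr PE).
- by elim/qmap_ind=> x a a'; rewrite !qE (pre_ractA PE).
- by move=> b; elim/qmap_ind=> x a; rewrite !qE (pre_lract PE).
- apply: spans_qmap (pre_lact_spans PE) => _ [b [x ->]].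
  by exists b, (qmap x); rewrite qE.
- apply: spans_qmap (pre_ract_spans PE) => _ [x [a ->]].
  by exists (qmap x), a; rewrite qE.
- elim/qmap_ind=> x c; elim/qmap_ind=> y; elim/qmap_ind=> z.
  by rewrite qDZ !qE (pre_rip_lin PE).
- by elim/qmap_ind=> x; elim/qmap_ind=> y; rewrite !qE (pre_rip_sym PE).
- by elim/qmap_ind=> x; elim/qmap_ind=> y a; rewrite !qE (pre_rip_ract PE).
- elim/qmap_ind=> x nx; apply/qcls_null => y.
  by rewrite -rip_qmap.
- move=> a; apply: in_span_trans (pre_rip_full PE a) => _ [x [y ->]].
  by apply: in_span_gen; exists (qmap x), (qmap y); rewrite qE.
- elim/qmap_ind=> y c; elim/qmap_ind=> x; elim/qmap_ind=> z.
  by rewrite qDZ !qE (pre_lip_lin PE).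
- by elim/qmap_ind=> x; elim/qmap_ind=> y; rewrite !qE (pre_lip_sym PE).
- by move=> b; elim/qmap_ind=> x; elim/qmap_ind=> y; rewrite !qE (pre_lip_lact PE).
- elim/qmap_ind=> x nx; apply/qcls_null/nullP => y.
  by rewrite -lip_qmap.
- move=> b; apply: in_span_trans (pre_lip_full PE b) => _ [x [y ->]].
  by apply: in_span_gen; exists (qmap x), (qmap y); rewrite qE.
- by move=> b; elim/qmap_ind=> x; elim/qmap_ind=> y; rewrite !qE (pre_rip_lact PE).
- by elim/qmap_ind=> x; elim/qmap_ind=> y a; rewrite !qE (pre_lip_ract PE).
- elim/qmap_ind=> x; elim/qmap_ind=> y; elim/qmap_ind=> z.
  by rewrite !qE (pre_lip_rip PE).
- split.
  + move=> g c; elim/qmap_ind=> x; elim/qmap_ind=> y.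
    by rewrite qDZ !qE qDZ (bm_actDr PE) (bm_actZr PE).
  + elim/qmap_ind=> x c g h.
    by rewrite !qE qDZ (bm_actDl PE) (bm_actZl PE).
  + by elim/qmap_ind=> x; rewrite !qE (bm_act1 PE).
  + by move=> g h; elim/qmap_ind=> x; rewrite !qE (bm_actM PE).
- move=> g; elim/qmap_ind=> x; elim/qmap_ind=> y; rewrite !qE (pre_act_rip PE).
  by apply: eq_tlift => g1 g2; rewrite !qE.
- move=> g; elim/qmap_ind=> x; elim/qmap_ind=> y; rewrite !qE (pre_act_lip PE).
  by apply: eq_tlift => g1 g2; rewrite !qE.
Qed.

End Quotient.

(** * The tensor product of equivalence bimodules *)

Section TensorProductBimodule.
Variables (R : realDomainType) (H : hopf_star_alg R) (C B A : Hstar_alg H).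
Variables (F : bimod C B) (E : bimod B A).
Hypotheses (FF : is_equiv_bimod F) (EE : is_equiv_bimod E).
Let PF := equiv_pre FF.
Let PE := equiv_pre EE.
Implicit Types (y : F) (x : E) (t u : btensor F E) (V : zmodType).

Lemma bpureDl y y' x : bpure (y + y') x = bpure y x + bpure y' x.
Proof. by rewrite /bpure tpureDl qclsD. Qed.

Lemma bpureDr y x x' : bpure y (x + x') = bpure y x + bpure y x'.
Proof. by rewrite /bpure tpureDr qclsD. Qed.

Lemma bpureZl c y x : bpure (c *: y) x = c *: bpure y x.
Proof. by rewrite /bpure tpureZl qclsZ. Qed.

Lemma bpureZr c y x : bpure y (c *: x) = c *: bpure y x.
Proof. by rewrite /bpure tpureZr qclsZ. Qed.

Lemma bpure_ract y b x : bpure (ract y b) x = bpure y (lact b x).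
Proof. by apply/qclsP/in_span_gen; exists y, b, x. Qed.

Lemma btensor_ind (Q : btensor F E -> Prop) : Q 0 ->
  (forall y x t, Q t -> Q (bpure y x + t)) -> forall t, Q t.
Proof.
move=> Q0 QD; elim/qind => v; elim/tensor_ind: v => [|y x v IH]; first exact: Q0.
by rewrite -qclsD; apply: QD.
Qed.

Lemma btensor_ext V (f h : btensor F E -> V) :
  {morph f : t u / t + u} -> {morph h : t u / t + u} ->
  (forall y x, f (bpure y x) = h (bpure y x)) -> forall t, f t = h t.
Proof.
move=> fD hD fh; elim/btensor_ind=> [|y x t IH]; last by rewrite fD hD fh IH.
by rewrite !additive_map0.
Qed.

Definition middle_balanced V (f : F -> E -> V) : Prop :=
  balanced2 f /\ forall y b x, f (ract y b) x = f y (lact b x).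

Section Lift.
Variables (V : zmodType) (f : F -> E -> V).
Hypothesis fB : middle_balanced f.

Lemma blift_qcls v : blift f (qcls (@balancing _ _ _ _ _ F E) v) = tlift f v.
Proof.
case: fB => fb fB'; have fD := tlift_add fb.
apply: repr_qcls => // c _ [y [b [x ->]]].
rewrite scalerBr -!tpureZl (additive_mapB fD) !tlift_pure // -(ractZl PF) fB'.
exact: subrr.
Qed.

Lemma blift_pure y x : blift f (bpure y x) = f y x.
Proof. by rewrite blift_qcls tlift_pure //; case: fB. Qed.

Lemma blift_add : {morph blift f : t u / t + u}.
Proof.
elim/qind=> v; elim/qind=> w; rewrite qclsD !blift_qcls.
by apply: tlift_add; case: fB.
Qed.

End Lift.

Lemma eq_blift V (f h : F -> E -> V) t :
  (forall y x, f y x = h y x) -> blift f t = blift h t.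
Proof. exact: eq_tlift. Qed.

Lemma blift_split V (f h : F -> E -> V) t :
  blift (fun y x => f y x + h y x) t = blift f t + blift h t.
Proof. exact: tlift_split. Qed.

Let lD := (lactDl PF, lactDr PF, lactDl PE, lactDr PE, ractDl PF, ractDr PF,
  ractDl PE, ractDr PE, bm_actDl PF, bm_actDr PF, bm_actDl PE, bm_actDr PE,
  @starSD _ H).
Let lZ := (lactZl PF, lactZr PF, lactZl PE, lactZr PE, ractZl PF, ractZr PF,
  ractZl PE, ractZr PE, bm_actZl PF, bm_actZr PF, bm_actZl PE, bm_actZr PE,
  @starSZ _ H).
Let pD := (ripDl PF, ripDr PF, lipDl PF, lipDr PF, ripDl PE, ripDr PE,
  lipDl PE, lipDr PE).
Let pZ := (ripZl PF, ripZr PF, lipZl PF, lipZr PF, ripZl PE, ripZr PE,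
  lipZl PE, lipZr PE, @cconjK R).

Lemma bt_lact_balanced c : middle_balanced (fun y x => bpure (lact c y) x).
Proof.
split; first by split=> *; rewrite ?(lD, lZ, bpureDl, bpureDr, bpureZl, bpureZr).
by move=> y b x; rewrite -(pre_lract PF) bpure_ract.
Qed.

Lemma bt_ract_balanced a : middle_balanced (fun y x => bpure y (ract x a)).
Proof.
split; first by split=> *; rewrite ?(lD, lZ, bpureDl, bpureDr, bpureZl, bpureZr).
by move=> y b x; rewrite (pre_lract PE) bpure_ract.
Qed.

Lemma bt_rip_balancedr y x :
  middle_balanced (fun y' x' => rip x (lact (rip y y') x')).
Proof.
split; first by split=> *; rewrite ?(lD, lZ, pD, pZ) ?(lD, lZ, pD, pZ).
by move=> y' b x'; rewrite (pre_rip_ract PF) (pre_lactA PE).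
Qed.

Lemma bt_rip_balancedl t' : middle_balanced (fun y x =>
  blift (fun y' x' => rip x (lact (rip y y') x')) t').
Proof.
split; last first.
  move=> y b x; apply: eq_blift => y' x'.
  by rewrite (rip_ractl PF) (pre_lactA PE) (rip_lactr PE) sa_starK.
split=> *; rewrite -?blift_split; apply: eq_blift => y' x';
  by rewrite ?(lD, lZ, pD, pZ) ?(lD, lZ, pD, pZ).
Qed.

Lemma bt_lip_balancedr y x :
  middle_balanced (fun y' x' => lip (ract y (lip x x')) y').
Proof.
split; first by split=> *; rewrite ?(lD, lZ, pD, pZ) ?(lD, lZ, pD, pZ).
by move=> y' b x'; rewrite (lip_ractr PF) (lip_lactr PE) (pre_ractA PF).
Qed.

Lemma bt_lip_balancedl t' : middle_balanced (fun y x =>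
  blift (fun y' x' => lip (ract y (lip x x')) y') t').
Proof.
split; last first.
  move=> y b x; apply: eq_blift => y' x'.
  by rewrite (pre_lip_lact PE) (pre_ractA PF).
split=> *; rewrite -?blift_split; apply: eq_blift => y' x';
  by rewrite ?(lD, lZ, pD, pZ) ?(lD, lZ, pD, pZ).
Qed.

Lemma bpure_act_balanced y x :
  balanced2 (fun g1 g2 => bpure (bm_act g1 y) (bm_act g2 x)).
Proof. by split=> *; rewrite ?(lD, lZ, bpureDl, bpureDr, bpureZl, bpureZr). Qed.

(** Here covariance of the module actions enters. That of the right action on [F] and that of the
    left action on [E] expand the two sides into the same threefold Sweedler sum, once the middle
    leg acting on [b] is moved across the tensor sign. *)
Lemma bt_act_balanced g : middle_balanced (fun y x =>
  \sw[g1, g2 <- g] bpure (bm_act g1 y) (bm_act g2 x)).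
Proof.
split.
  split=> *; rewrite -?tlift_split; apply: eq_tlift => g1 g2;
  by rewrite ?(lD, lZ, bpureDl, bpureDr, bpureZl, bpureZr).
move=> y b x.
pose f g1 g2 g3 := bpure (ract (bm_act g1 y) (ha_act g2 b)) (bm_act g3 x).
transitivity (\sw[p, g3 <- g] \sw[g1, g2 <- p] f g1 g2 g3).
  apply: eq_tlift => p g3; rewrite (bm_act_ract FF).
  by rewrite (tlift_map _ _ (fun y y' => bpureDl y y' _)).
rewrite sw_coassoc; last first.
  by split=> ?; split=> *; rewrite /f ?(lD, ha_actDl, ha_actDr, bpureDl, bpureDr)
    // ?(lZ, ha_actZl, ha_actZr, bpureZl, bpureZr).
apply: eq_tlift => g1 p; rewrite (bm_act_lact EE).
rewrite (tlift_map _ _ (fun x x' => bpureDr _ x x')).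
by apply: eq_tlift => g2 g3; rewrite /f bpure_ract.
Qed.

Definition bt_bimod : bimod C A := {|
  bm_car := btensor F E;
  lact := @bt_lact _ _ _ _ _ F E;
  ract := @bt_ract _ _ _ _ _ F E;
  lip := @bt_lip _ _ _ _ _ F E;
  rip := @bt_rip _ _ _ _ _ F E;
  bm_act := @bt_act _ _ _ _ _ F E
|}.

Lemma bt_lact_pure c y x : bt_lact c (bpure y x) = bpure (lact c y) x.
Proof. exact: (blift_pure (bt_lact_balanced c)). Qed.

Lemma bt_ract_pure y x a : bt_ract (bpure y x) a = bpure y (ract x a).
Proof. exact: (blift_pure (bt_ract_balanced a)). Qed.

Lemma bt_act_pure g y x :
  bt_act g (bpure y x) = \sw[g1, g2 <- g] bpure (bm_act g1 y) (bm_act g2 x).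
Proof. exact: (blift_pure (bt_act_balanced g)). Qed.

Lemma bt_rip_pure y x y' x' :
  bt_rip (bpure y x) (bpure y' x') = rip x (lact (rip y y') x').
Proof.
rewrite /bt_rip (blift_pure (bt_rip_balancedl _)).
exact: (blift_pure (bt_rip_balancedr y x)).
Qed.

Lemma bt_lip_pure y x y' x' :
  bt_lip (bpure y x) (bpure y' x') = lip (ract y (lip x x')) y'.
Proof.
rewrite /bt_lip (blift_pure (bt_lip_balancedl _)).
exact: (blift_pure (bt_lip_balancedr y x)).
Qed.

Lemma bt_lactDr c : {morph @bt_lact _ _ _ _ _ F E c : t u / t + u}.
Proof. exact: (blift_add (bt_lact_balanced c)). Qed.

Lemma bt_ractDl a : {morph (@bt_ract _ _ _ _ _ F E)^~ a : t u / t + u}.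
Proof. exact: (blift_add (bt_ract_balanced a)). Qed.

Lemma bt_actDr g : {morph @bt_act _ _ _ _ _ F E g : t u / t + u}.
Proof. exact: (blift_add (bt_act_balanced g)). Qed.

Lemma bt_ripDl t' : {morph (@bt_rip _ _ _ _ _ F E)^~ t' : t u / t + u}.
Proof. exact: (blift_add (bt_rip_balancedl t')). Qed.

Lemma bt_ripDr t : {morph bt_rip t : t' u' / t' + u'}.
Proof.
move=> t' u'; rewrite /bt_rip -blift_split; apply: eq_blift => y x.
exact: (blift_add (bt_rip_balancedr y x)).
Qed.

Lemma bt_lipDl t' : {morph (@bt_lip _ _ _ _ _ F E)^~ t' : t u / t + u}.
Proof. exact: (blift_add (bt_lip_balancedl t')). Qed.

Lemma bt_lipDr t : {morph bt_lip t : t' u' / t' + u'}.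
Proof.
move=> t' u'; rewrite /bt_lip -blift_split; apply: eq_blift => y x.
exact: (blift_add (bt_lip_balancedr y x)).
Qed.

Let btD := (bt_lactDr, bt_ractDl, bt_actDr, bt_ripDl, bt_ripDr, bt_lipDl,
  bt_lipDr).
Let btE := (bt_lact_pure, bt_ract_pure, bt_act_pure, bt_rip_pure, bt_lip_pure).

(** Applying covariance outside in distributes four legs as g1 to [x], g2 to [y], g3 to [y'], g4 to
    [x']. On the right-hand side the legs come in pairs, and since [starS] flips the first pair, g1
    again reaches [x] and g2 reaches [y]. *)
Lemma bt_act_rip_pure g y x y' x' :
  ha_act g (rip x (lact (rip y y') x'))
  = \sw[g1, g2 <- g] bt_rip (bt_act (starS g1) (bpure y x))
                            (bt_act g2 (bpure y' x')).
Proof.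
pose f g1 g2 g3 g4 := rip (bm_act (starS g1) x)
  (lact (rip (bm_act (starS g2) y) (bm_act g3 y')) (bm_act g4 x')).
transitivity (\sw[g1, p <- g] \sw[q, g4 <- p] \sw[g2, g3 <- q] f g1 g2 g3 g4).
  rewrite (pre_act_rip PE); apply: eq_tlift => g1 p.
  rewrite (bm_act_lact EE) (tlift_map _ _ (ripDr PE _)); apply: eq_tlift => q g4.
  rewrite (pre_act_rip PF) (tlift_map _ _ (fun b b' => lactDl PE b b' _)).
  by rewrite (tlift_map _ _ (ripDr PE _)).
rewrite -sw_coassoc4r; last first.
  by split=> ? ?; split=> *; rewrite /f ?lD ?pD ?lD ?pD // ?lZ ?pZ ?lZ ?pZ.
apply: eq_tlift => p q; rewrite !bt_act_pure.
rewrite sw_starS; last exact: bpure_act_balanced.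
rewrite (tlift_map _ _ (@bt_ripDl _)); apply: eq_tlift => g1 g2.
rewrite (tlift_map _ _ (@bt_ripDr _)); apply: eq_tlift => g3 g4.
by rewrite bt_rip_pure.
Qed.

Lemma bt_act_lip_pure g y x y' x' :
  ha_act g (lip (ract y (lip x x')) y')
  = \sw[g1, g2 <- g] bt_lip (bt_act g1 (bpure y x))
                            (bt_act (starS g2) (bpure y' x')).
Proof.
pose f g1 g2 g3 g4 := lip (ract (bm_act g1 y)
  (lip (bm_act g2 x) (bm_act (starS g3) x'))) (bm_act (starS g4) y').
transitivity (\sw[p, g4 <- g] \sw[g1, q <- p] \sw[g2, g3 <- q] f g1 g2 g3 g4).
  rewrite (pre_act_lip PF); apply: eq_tlift => p g4.
  rewrite (bm_act_ract FF) (tlift_map _ _ (lipDl PF _)); apply: eq_tlift => g1 q.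
  rewrite (pre_act_lip PE) (tlift_map _ _ (ractDr PF _)).
  by rewrite (tlift_map _ _ (lipDl PF _)).
rewrite -sw_coassoc4l; last first.
  by split=> ? ?; split=> *; rewrite /f ?lD ?pD ?lD ?pD // ?lZ ?pZ ?lZ ?pZ.
apply: eq_tlift => p q; rewrite !bt_act_pure.
rewrite sw_starS; last exact: bpure_act_balanced.
rewrite (tlift_map _ _ (@bt_lipDl _)); apply: eq_tlift => g1 g2.
rewrite (tlift_map _ _ (@bt_lipDr _)); apply: eq_tlift => g3 g4.
by rewrite bt_lip_pure.
Qed.

Lemma bt_lactDl t : {morph (@bt_lact _ _ _ _ _ F E)^~ t : c c' / c + c'}.
Proof.
move=> c c'; move: t; apply: btensor_ext => [t u|t u|y x]; rewrite ?btD //.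
  by rewrite addrACA.
by rewrite !btE lD bpureDl.
Qed.

Lemma bt_ractDr t : {morph bt_ract t : a a' / a + a'}.
Proof.
move=> a a'; move: t; apply: btensor_ext => [t u|t u|y x]; rewrite ?btD //.
  by rewrite addrACA.
by rewrite !btE lD bpureDr.
Qed.

Lemma spans_btensor (P : btensor F E -> Prop) :
  (forall y x, in_span P (bpure y x)) -> spans P.
Proof.
move=> Pp; elim/btensor_ind=> [|y x t IH]; first exact: in_span0.
exact: in_spanD.
Qed.

Lemma bt_pre_equiv : is_pre_equiv bt_bimod.
Proof.
have sD := @scalerDr (Cx R).
split=> /=.
- move=> t; apply: map_linear => [|k c]; first exact: bt_lactDl.
  move: t; apply: btensor_ext => [t u|t u|y x]; rewrite ?btD ?sD //.
  by rewrite !btE lZ bpureZl.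
- move=> c; apply: map_linear => [|k]; first exact: bt_lactDr.
  apply: btensor_ext => [t u|t u|y x]; rewrite ?(sD, btD) ?sD //.
  by rewrite -bpureZl !btE lZ bpureZl.
- move=> c c'; apply: btensor_ext => [t u|t u|y x]; rewrite ?btD //.
  by rewrite !btE (pre_lactA PF).
- move=> a; apply: map_linear => [|k]; first exact: bt_ractDl.
  apply: btensor_ext => [t u|t u|y x]; rewrite ?(sD, btD) ?sD //.
  by rewrite -bpureZl !btE bpureZl.
- move=> t; apply: map_linear => [|k a]; first exact: bt_ractDr.
  move: t; apply: btensor_ext => [t u|t u|y x]; rewrite ?btD ?sD //.
  by rewrite !btE lZ bpureZr.
- move=> t a a'; move: t; apply: btensor_ext => [t u|t u|y x]; rewrite ?btD //.
  by rewrite !btE (pre_ractA PE).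
- move=> c t a; move: t; apply: btensor_ext => [t u|t u|y x]; rewrite ?btD //.
  by rewrite !btE.
- apply: spans_btensor => y x; move: (pre_lact_spans PF y).
  apply: (@in_span_map _ _ _ _ _ (fun y => bpure y x) id) => [y1 y2|c y1|].
  + exact: bpureDl.
  + exact: bpureZl.
  + move=> _ [c [y' ->]]; apply: in_span_gen; exists c, (bpure y' x).
    by rewrite btE.
- apply: spans_btensor => y x; move: (pre_ract_spans PE x).
  apply: (@in_span_map _ _ _ _ _ (fun x => bpure y x) id) => [x1 x2|c x1|].
  + exact: bpureDr.
  + exact: bpureZr.
  + move=> _ [x' [a ->]]; apply: in_span_gen; exists (bpure y x'), a.
    by rewrite btE.
- move=> t; apply: map_linear => [|k]; first exact: bt_ripDr.
  move=> t'; move: t; apply: btensor_ext => [t u|t u|y x]; rewrite ?btD ?sD //.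
  move: t'; apply: btensor_ext => [t u|t u|y' x']; rewrite ?sD ?btD ?sD //.
  by rewrite -bpureZr !btE lZ pZ.
- move=> t t'; move: t; apply: btensor_ext => [t u|t u|y x];
    rewrite ?btD ?sa_starD //.
  move: t'; apply: btensor_ext => [t u|t u|y' x'];
    rewrite ?btD ?sa_starD //.
  by rewrite !btE -(pre_rip_sym PE) (pre_rip_lact PE) -(pre_rip_sym PF).
- move=> t t' a; move: t; apply: btensor_ext => [t u|t u|y x];
    rewrite ?btD ?sa_mulDl //.
  move: t'; apply: btensor_ext => [t u|t u|y' x'];
    rewrite ?btD ?sa_mulDl //.
  by rewrite !btE -(pre_lract PE) (pre_rip_ract PE).
(* Every [rip x x'] is expanded twice: first [x'] through the spanning set of products [lact b x2],
   then [b] through the values of the inner product of [F]. The terms reached are inner products of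
   simple tensors. *)
- move=> a; apply: in_span_trans (pre_rip_full PE a) => _ [x [x' ->]].
  move: (pre_lact_spans PE x').
  apply: in_span_map (ripDr PE x) (fun c => ripZr PE c x) _ => _ [b [x2 ->]].
  move: (pre_rip_full PF b).
  apply: (@in_span_map _ _ _ _ _ (fun b => rip x (lact b x2)) id) => [b1 b2|c b1|].
  + by rewrite lD pD.
  + by rewrite lZ pZ.
  + move=> _ [y [y' ->]]; apply: in_span_gen; exists (bpure y x), (bpure y' x2).
    by rewrite btE.
- move=> t'; apply: map_linear => [|k]; first exact: bt_lipDl.
  apply: btensor_ext => [t u|t u|y x]; rewrite ?sD ?btD ?sD //.
  move: t'; apply: btensor_ext => [t u|t u|y' x']; rewrite ?btD ?sD //.
  by rewrite -bpureZl !btE lZ pZ.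
- move=> t t'; move: t; apply: btensor_ext => [t u|t u|y x];
    rewrite ?btD ?sa_starD //.
  move: t'; apply: btensor_ext => [t u|t u|y' x'];
    rewrite ?btD ?sa_starD //.
  by rewrite !btE -(pre_lip_sym PF) (lip_ractr PF) -(pre_lip_sym PE).
- move=> c t t'; move: t; apply: btensor_ext => [t u|t u|y x];
    rewrite ?btD ?sa_mulDr //.
  move: t'; apply: btensor_ext => [t u|t u|y' x'];
    rewrite ?btD ?sa_mulDr //.
  by rewrite !btE (pre_lract PF) (pre_lip_lact PF).
- move=> c; apply: in_span_trans (pre_lip_full PF c) => _ [y [y' ->]].
  move: (pre_ract_spans PF y).
  apply: in_span_map (lipDl PF y') (fun c y => lipZl PF c y y') _ => _ [y2 [b ->]].
  move: (pre_lip_full PE b).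
  apply: (@in_span_map _ _ _ _ _ (fun b => lip (ract y2 b) y') id) => [b1 b2|k b1|].
  + by rewrite lD pD.
  + by rewrite lZ pZ.
  + move=> _ [x [x' ->]]; apply: in_span_gen; exists (bpure y2 x), (bpure y' x').
    by rewrite btE.
- move=> c t t'; move: t; apply: btensor_ext => [t u|t u|y x]; rewrite ?btD //.
  move: t'; apply: btensor_ext => [t u|t u|y' x']; rewrite ?btD //.
  by rewrite !btE (pre_rip_lact PF).
- move=> t t' a; move: t; apply: btensor_ext => [t u|t u|y x]; rewrite ?btD //.
  move: t'; apply: btensor_ext => [t u|t u|y' x']; rewrite ?btD //.
  by rewrite !btE (pre_lip_ract PE).
- move=> t t' t''; move: t; apply: btensor_ext => [t u|t u|y x];
    rewrite ?btD ?bt_lactDl //.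
  move: t'; apply: btensor_ext => [t u|t u|y' x'];
    rewrite ?(btD, bt_lactDl, bt_ractDr) //.
  move: t''; apply: btensor_ext => [t u|t u|y'' x''];
    rewrite ?(btD, bt_lactDl, bt_ractDr) //.
  (* Compatibility in [F] turns the left action into right multiplications on [y]; these cross the
     tensor sign, and compatibility in [E] then yields the right action. *)
  by rewrite !btE (pre_lip_rip PF) !bpure_ract (pre_lip_rip PE).
- split=> /=.
  + move=> g; apply: map_linear => [|k]; first exact: bt_actDr.
    apply: btensor_ext => [t u|t u|y x]; rewrite ?sD ?btD ?sD //.
    rewrite -bpureZl !btE (tlift_map _ _ (sD _ k)); apply: eq_tlift => g1 g2.
    by rewrite lZ bpureZl.
  + move=> t; apply: map_linear => [g h|k g]; move: t;
      apply: btensor_ext => [t u|t u|y x]; rewrite ?sD ?btD ?sD ?btE //.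
    * by rewrite addrACA.
    * exact: sw_add (bpure_act_balanced y x) g h.
    * rewrite (sw_scale (bpure_act_balanced y x)) (tlift_map _ _ (sD _ k)).
      by apply: eq_tlift => g1 g2; rewrite lZ bpureZl.
  + apply: btensor_ext => [t u|t u|y x]; rewrite ?btD //.
    by rewrite btE (sw_1 (bpure_act_balanced y x)) (bm_act1 PF) (bm_act1 PE).
  + move=> g h; apply: btensor_ext => [t u|t u|y x]; rewrite ?btD //.
    rewrite !btE (sw_mul _ _ (bpure_act_balanced y x)) (tlift_map _ _ (bt_actDr g)).
    rewrite tlift_exchange; apply: eq_tlift => h1 h2; rewrite btE.
    by apply: eq_tlift => g1 g2; rewrite (bm_actM PF) (bm_actM PE).
- move=> g t t'; move: t; apply: btensor_ext => [t u|t u|y x].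
  + by rewrite btD ha_actDr.
  + by rewrite -tlift_split; apply: eq_tlift => g1 g2; rewrite !btD.
  move: t'; apply: btensor_ext => [t u|t u|y' x'].
  + by rewrite btD ha_actDr.
  + by rewrite -tlift_split; apply: eq_tlift => g1 g2; rewrite !btD.
  by rewrite btE bt_act_rip_pure.
- move=> g t t'; move: t; apply: btensor_ext => [t u|t u|y x].
  + by rewrite btD ha_actDr.
  + by rewrite -tlift_split; apply: eq_tlift => g1 g2; rewrite !btD.
  move: t'; apply: btensor_ext => [t u|t u|y' x'].
  + by rewrite btD ha_actDr.
  + by rewrite -tlift_split; apply: eq_tlift => g1 g2; rewrite !btD.
  by rewrite btE bt_act_lip_pure.
Qed.

Lemma itens_equiv : is_equiv_bimod (itens_bimod F E).
Proof. exact: (quot_equiv_bimod bt_pre_equiv). Qed.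

Lemma ipureDl y y' x : ipure (y + y') x = ipure y x + ipure y' x.
Proof. by rewrite /ipure bpureDl; exact: (@qmapD _ _ _ _ bt_bimod). Qed.

Lemma ipureDr y x x' : ipure y (x + x') = ipure y x + ipure y x'.
Proof. by rewrite /ipure bpureDr; exact: (@qmapD _ _ _ _ bt_bimod). Qed.

Lemma ipureZl c y x : ipure (c *: y) x = c *: ipure y x.
Proof. by rewrite /ipure bpureZl; exact: (@qmapZ _ _ _ _ bt_bimod). Qed.

Lemma ipureZr c y x : ipure y (c *: x) = c *: ipure y x.
Proof. by rewrite /ipure bpureZr; exact: (@qmapZ _ _ _ _ bt_bimod). Qed.

Lemma itens_wd : itens_well_defined F E.
Proof.
have PT := bt_pre_equiv; split.
- by move=> c y x; rewrite [LHS](lact_qmap PT) /= bt_lact_pure.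
- by move=> y x a; rewrite [LHS](ract_qmap PT) /= bt_ract_pure.
- by move=> y x y' x'; rewrite [LHS](rip_qmap PT) /= bt_rip_pure.
- by move=> y x y' x'; rewrite [LHS](lip_qmap PT) /= bt_lip_pure.
- move=> g y x; rewrite [LHS](bm_act_qmap PT) /= bt_act_pure.
  exact: (tlift_map _ _ (@qmapD _ _ _ _ bt_bimod)).
- exact: (nullP PT).
Qed.

Lemma itens_sum (q : itens_bimod F E) :
  exists s : seq (F * E), q = \sum_(p <- s) ipure p.1 p.2.
Proof.
elim/qind: q; elim/btensor_ind=> [|y x t [s e]].
  by exists [::]; rewrite big_nil.
by exists ((y, x) :: s); rewrite big_cons -e /ipure qclsD.
Qed.

Lemma spans_itens (P : itens_bimod F E -> Prop) :
  (forall y x, in_span P (ipure y x)) -> spans P.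
Proof.
move=> Pp q; have [s ->] := itens_sum q.
exact: in_span_sum.
Qed.

End TensorProductBimodule.

(** * Canonical and conjugate bimodules *)

Section Canonical.
Variables (R : realDomainType) (H : hopf_star_alg R) (A : Hstar_alg H).

(** Idempotency supplies the spanning and fullness conditions, non-degeneracy of the algebra that of
    the inner products. Covariance is the one of the product: the [starS] in the axiom cancels
    against the one produced by moving the action through the star. *)
Lemma canonical_equiv : is_equiv_bimod (canonical_bimod A).
Proof.
have nA := ha_nondeg A; have iA := @ha_idem _ _ A.
have star0 (a : A) : sa_star a = 0 -> a = 0.
  by move=> a0; rewrite -[a]sa_starK a0 sa_star0.
split=> /=.
- exact: sa_mul_linl.
- exact: sa_mul_linr.
- by move=> a b x; rewrite sa_mulA.
- exact: sa_mul_linl.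
- exact: sa_mul_linr.
- by move=> x a b; rewrite sa_mulA.
- by move=> b x a; rewrite sa_mulA.
- exact: iA.
- exact: iA.
- by move=> x; apply: sa_mul_linr.
- by move=> x y; rewrite sa_starM sa_starK.
- by move=> x y a; rewrite sa_mulA.
- by move=> x nx; apply: star0; apply: nA.1.
- move=> a; apply: in_span_trans (iA a) => _ [x [y ->]].
  by apply: in_span_gen; exists (sa_star x), y; rewrite sa_starK.
- by move=> y; apply: sa_mul_linl.
- by move=> x y; rewrite sa_starM sa_starK.
- by move=> b x y; rewrite sa_mulA.
- by move=> x nx; apply: nA.1 => b; rewrite -[b]sa_starK.
- move=> a; apply: in_span_trans (iA a) => _ [x [y ->]].
  by apply: in_span_gen; exists x, (sa_star y); rewrite sa_starK.
- by move=> b x y; rewrite sa_starM sa_mulA.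
- by move=> x y a; rewrite sa_starM sa_starK sa_mulA.
- by move=> x y z; rewrite sa_mulA.
- exact: sact_Hmodule (ha_actP A).
- move=> g x y; rewrite ha_act_mul; apply: eq_tlift => g1 g2.
  by rewrite (sact_star (ha_actP A)) hs_S_star.
- move=> g x y; rewrite ha_act_mul; apply: eq_tlift => g1 g2.
  by rewrite (sact_star (ha_actP A)) hs_S_star.
Qed.

End Canonical.

Section Conjugate.
Variables (R : realDomainType) (H : hopf_star_alg R) (B A : Hstar_alg H).

(** The same generators serve, with conjugated coefficients; the identity is semilinear from [V] to
    its conjugate. *)
Lemma in_span_conj (V : lmodType (Cx R)) (P : V -> Prop) v :
  in_span P v -> in_span (V := conj_mod V) P v.
Proof.
apply: (@in_span_map _ _ (conj_mod V) P P id (@cconj R)) => // [c x|u Pu].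
  by rewrite -[RHS]/(cconj (cconj c) *: x) cconjK.
exact: in_span_gen.
Qed.

(** Left and right axioms of [E] change places. The twisted action is a module structure because
    [starS] is multiplicative; it is linear in H because conjugated scalars absorb the antilinearity
    of [starS]; and the inner products stay covariant because [starS] is an involution. *)
Lemma conj_equiv (E : bimod B A) : is_equiv_bimod E -> is_equiv_bimod (conj_bimod E).
Proof.
move=> EE; have PE := equiv_pre EE.
have cZ c (x : conj_mod E) : c *: x = cconj c *: (x : E) by [].
split=> /=.
- move=> x; apply: map_linear => [a a'|c a]; first by rewrite sa_starD (ractDr PE).
  by rewrite sa_starZ (ractZr PE).
- move=> a; apply: map_linear => [x x'|c x]; first exact: (ractDl PE).
  by rewrite !cZ (ractZl PE).
- by move=> a a' x; rewrite sa_starM (pre_ractA PE).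
- move=> b; apply: map_linear => [x x'|c x]; first exact: (lactDr PE).
  by rewrite !cZ (lactZr PE).
- move=> x; apply: map_linear => [b b'|c b]; first by rewrite sa_starD (lactDl PE).
  by rewrite sa_starZ (lactZl PE).
- by move=> x b b'; rewrite sa_starM (pre_lactA PE).
- by move=> a x b; rewrite (pre_lract PE).
- move=> x; apply: (in_span_conj (V := E)).
  apply: in_span_trans (pre_ract_spans PE x) => _ [y [a ->]].
  by apply: in_span_gen; exists (sa_star a), y; rewrite sa_starK.
- move=> x; apply: (in_span_conj (V := E)).
  apply: in_span_trans (pre_lact_spans PE x) => _ [b [y ->]].
  by apply: in_span_gen; exists y, (sa_star b); rewrite sa_starK.
- move=> x; apply: map_linear => [y y'|c y]; first exact: (lipDr PE).
  by rewrite cZ (lipZr PE) cconjK.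
- exact: (pre_lip_sym PE).
- by move=> x y b; rewrite (lip_lactr PE) sa_starK.
- exact: (lip_nondeg EE).
- exact: (pre_lip_full PE).
- move=> y; apply: map_linear => [x x'|c x]; first exact: (ripDl PE).
  by rewrite cZ (ripZl PE) cconjK.
- exact: (pre_rip_sym PE).
- by move=> a x y; rewrite (rip_ractl PE) sa_starK.
- exact: (rip_nondeg EE).
- exact: (pre_rip_full PE).
- by move=> a x y; rewrite (pre_lip_ract PE).
- by move=> x y b; rewrite (pre_rip_lact PE).
- move=> x y z; rewrite -(pre_rip_sym PE) -(pre_lip_sym PE).
  by rewrite (pre_lip_rip PE).
- split.
  + move=> g; apply: map_linear => [x x'|c x]; first exact: (bm_actDr PE).
    by rewrite !cZ (bm_actZr PE).
  + move=> x; apply: map_linear => [g h|c g].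
      by rewrite -!/(starS _) starSD (bm_actDl PE).
    by rewrite -!/(starS _) starSZ (bm_actZl PE).
  + by move=> x; rewrite -/(starS _) starS1 (bm_act1 PE).
  + by move=> g h x; rewrite -!/(starS _) starSM (bm_actM PE).
- move=> g x y; rewrite (pre_act_lip PE); apply: eq_tlift => g1 g2.
  by rewrite hs_S_star.
- move=> g x y; rewrite (pre_act_rip PE); apply: eq_tlift => g1 g2.
  by rewrite hs_S_star.
Qed.

End Conjugate.

(** * Complete positivity *)

Section Positivity.
Variable R : realDomainType.

Lemma cge0D (z w : Cx R) : cge0 z -> cge0 w -> cge0 (z + w).
Proof.
case: z w => [a b] [c d] [/= a0 ->] [/= c0 ->].
by split; rewrite /= ?addr_ge0 ?addr0.
Qed.

Lemma cge0_sum n (F : 'I_n -> Cx R) : (forall i, cge0 (F i)) -> cge0 (\sum_i F i).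
Proof.
by move=> F0; elim/big_ind: _ => //; exact: cge0D.
Qed.

Section Pullback.
Variables (A B : star_alg R) (V : zmodType).
Variables (ip : V -> V -> A) (h : V -> B -> V -> A) (act : B -> V -> V).
Hypothesis ipDl : forall y, {morph ip^~ y : x x' / x + x'}.
Hypothesis ipDr : forall x, {morph ip x : y y' / y + y'}.
Hypothesis hD : forall x y, {morph h x ^~ y : b b' / b + b'}.
Hypothesis hZ : forall c x b y, h x (c *: b) y = c *: h x b y.
Hypothesis hM : forall x b b' y,
  h x (sa_mul (sa_star b) b') y = ip (act b x) (act b' y).

(* A positive functional on M_n(A) pulls back to the functional
   b |-> w (sum_kl h x_ik b_kl x_jl)_ij on M_N(B), and complete positivity of ip
   says that the latter is positive. *)
Lemma positive_pullback N n (b : mx_star_alg B N) (x : 'I_n -> 'I_N -> V) :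
  completely_positive ip -> positive_elt b ->
  positive_elt (A := mx_star_alg A n)
    [ffun p => \sum_k \sum_l h (x p.1 k) (b (k, l)) (x p.2 l)].
Proof.
move=> ipP bP w [w_lin w_pos].
have wD (X Y : mx_star_alg A n) : w (X + Y) = w X + w Y.
  by have := w_lin 1 X Y; rewrite scale1r mul1r.
pose T (d : mx_star_alg B N) : mx_star_alg A n :=
  [ffun p => \sum_k \sum_l h (x p.1 k) (d (k, l)) (x p.2 l)].
have T_lin c d d' : T (c *: d + d') = c *: T d + T d'.
  apply/ffunP=> p; rewrite !ffunE scaler_sumr -big_split; apply: eq_bigr => k _.
  rewrite scaler_sumr -big_split; apply: eq_bigr => l _ /=.
  by rewrite !ffunE hD hZ.
apply: (bP (fun d => w (T d))); split=> [c d d'|d]; first by rewrite T_lin w_lin.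
(* Each row [m] of [d] contributes the Gram matrix of its own vectors [z m i], to which complete
   positivity of [ip] applies. *)
pose z m i := \sum_k act (d (m, k)) (x i k).
have -> : T (sa_mul (sa_star d) d)
    = \sum_m ([ffun p => ip (z m p.1) (z m p.2)] : mx_star_alg A n).
  apply/ffunP=> p; rewrite ffunE sum_ffunE.
  under [RHS]eq_bigr => m _.
    rewrite ffunE /z (additive_map_sum (ipDl _)).
    under eq_bigr => k _ do rewrite (additive_map_sum (ipDr _)).
    over.
  rewrite [RHS]exchange_big; apply: eq_bigr => k _ /=.
  rewrite exchange_big; apply: eq_bigr => l _ /=.
  rewrite ffunE (additive_map_sum (hD _ _)); apply: eq_bigr => m _ /=.
  by rewrite ffunE hM.
rewrite (additive_map_sum wD); apply: cge0_sum => m.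
by apply: ipP; split.
Qed.

End Pullback.

(** Gives finitely many sums of simple tensors a common family of first factors, so that one Gram
    matrix of the [u k] governs all their inner products. The lists are concatenated with each entry
    tagged by its origin [i]; for other indices the second factor is set to 0, which contributes
    nothing. *)
Lemma common_factor U (V W : zmodType) (f : U -> V -> W) n
    (s : 'I_n -> seq (U * V)) : (forall u, f u 0 = 0) ->
  exists N (u : 'I_N -> U) (v : 'I_n -> 'I_N -> V),
    forall i, \sum_(p <- s i) f p.1 p.2 = \sum_k f (u k) (v i k).
Proof.
move=> f0; pose L := flatten [seq [seq (i, p) | p <- s i] | i <- enum 'I_n].
exists (size L), (fun k => (tnth (in_tuple L) k).2.1).
exists (fun i k => if (tnth (in_tuple L) k).1 == i then
  (tnth (in_tuple L) k).2.2 else 0) => i.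
transitivity (\sum_(q <- L) f q.2.1 (if q.1 == i then q.2.2 else 0)); last first.
  by rewrite big_tnth.
rewrite big_flatten big_map big_enum /= (bigD1 i) //= big_map [X in _ + X]big1.
  by rewrite addr0; apply: eq_bigr => p _; rewrite eqxx.
by move=> j ji; rewrite big_map big1 // => p _; rewrite (negPf ji) f0.
Qed.

End Positivity.

Section StrongBimodules.
Variables (R : realDomainType) (H : hopf_star_alg R).

(** The matrix is a square: it is the product of the star of [X] with [X], where [X] has [a] as its
    first row and zeros elsewhere. For [n] equal to 0 there is no first row, but then all matrices
    coincide. *)
Lemma positive_gram (A : star_alg R) n (a : 'I_n -> A) :
  positive_elt (A := mx_star_alg A n) [ffun p => sa_mul (sa_star (a p.1)) (a p.2)].
Proof.
case: n a => [|n] a w [w_lin w_pos].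
  have -> : [ffun p => sa_mul (sa_star (a p.1)) (a p.2)]
      = sa_mul (sa_star 0) (0 : mx_star_alg A 0) by apply/ffunP=> -[[]].
  exact: w_pos.
pose X : mx_star_alg A n.+1 := [ffun p => if p.1 == ord0 then a p.2 else 0].
suff -> : [ffun p => sa_mul (sa_star (a p.1)) (a p.2)] = sa_mul (sa_star X) X.
  exact: w_pos.
apply/ffunP=> p; rewrite !ffunE (bigD1 ord0) //= big1 ?addr0 ?ffunE //=.
by move=> k /negPf k0; rewrite !ffunE /= k0 sa_star0 sa_mul0l.
Qed.

Lemma canonical_strong (A : Hstar_alg H) : is_strong_equiv_bimod (canonical_bimod A).
Proof.
split; first exact: canonical_equiv.
- move=> n a; have := positive_gram (fun i => sa_star (a i)).
  by congr positive_elt; apply/ffunP=> p; rewrite !ffunE /= sa_starK.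
- by move=> n a; apply: positive_gram.
Qed.

Lemma conj_strong (B A : Hstar_alg H) (E : bimod B A) :
  is_strong_equiv_bimod E -> is_strong_equiv_bimod (conj_bimod E).
Proof. by case=> EE lcp rcp; split; first exact: conj_equiv. Qed.

(** With common first factors [y k], the [rip] of two tensors is the double sum of the terms <x_ik,
    <y_k, y_l> x_jl>. This is the pullback, through the completely positive [rip] of [E], of a Gram
    matrix over B that is positive because [rip] of [F] is completely positive. For [lip] the common
    factors are taken in [E], and [F] and [E] exchange roles. *)
Lemma itens_strong (C B A : Hstar_alg H) (F : bimod C B) (E : bimod B A) :
  is_strong_equiv_bimod F -> is_strong_equiv_bimod E ->
  is_strong_equiv_bimod (itens_bimod F E).
Proof.
case=> FF lF rF [EE lE rE]; have PF := equiv_pre FF; have PE := equiv_pre EE.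
have TT := itens_equiv FF EE; have PT := equiv_pre TT.
have WD := itens_wd FF EE.
split=> // n q.
- have [s sE] := choice (fun i => itens_sum (q i)).
  have [|N [x [y xyE]]] := @common_factor _ _ _ (fun x y => ipure y x) n
      (fun i => [seq (p.2, p.1) | p <- s i]).
    by move=> x; apply: (additive_map0 (fun y y' => ipureDl y y' x)).
  have qE i : q i = \sum_k ipure (y i k) (x k) by rewrite sE -xyE big_map.
  (* Right multiplication by the starred element takes the part of the left action [act]; the
     starred product in [hM] is then moved across [lip] by [lip_ractr]. *)
  have := @positive_pullback _ C B F (@lip _ _ _ _ F)
    (fun y b y' => lip (ract y b) y') (fun b y => ract y (sa_star b))
    (lipDl PF) (lipDr PF) _ _ _ N n _ y lF (lE _ x).
  set M := [ffun p => _]; set M' := [ffun p => _].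
  have -> : M = M'.
    apply/ffunP=> p; rewrite !ffunE !qE (additive_map_sum (lipDl PT _)).
    apply: eq_bigr => k _; rewrite (additive_map_sum (lipDr PT _)).
    by apply: eq_bigr => l _; rewrite (itens_lip WD) ffunE.
  apply.
  + by move=> y1 y2 b b'; rewrite (ractDr PF) (lipDl PF).
  + by move=> c y1 b y2; rewrite (ractZr PF) (lipZl PF).
  + by move=> y1 b b' y2; rewrite (pre_ractA PF) (lip_ractr PF) sa_starK.
- have [s sE] := choice (fun i => itens_sum (q i)).
  have [|N [y [x yxE]]] := @common_factor _ _ _ (@ipure _ _ _ _ _ F E) n s.
    by move=> y; apply: (additive_map0 (fun x x' => ipureDr y x x')).
  have qE i : q i = \sum_k ipure (y k) (x i k) by rewrite sE yxE.
  have := @positive_pullback _ A B E (@rip _ _ _ _ E)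
    (fun x b x' => rip x (lact b x')) (fun b x => lact b x)
    (ripDl PE) (ripDr PE) _ _ _ N n _ x rE (rF _ y).
  set M := [ffun p => _]; set M' := [ffun p => _].
  have -> : M = M'.
    apply/ffunP=> p; rewrite !ffunE !qE (additive_map_sum (ripDl PT _)).
    apply: eq_bigr => k _; rewrite (additive_map_sum (ripDr PT _)).
    by apply: eq_bigr => l _; rewrite (itens_rip WD) ffunE.
  apply.
  + by move=> x1 x2 b b'; rewrite (lactDl PE) (ripDr PE).
  + by move=> c x1 b x2; rewrite (lactZl PE) (ripZr PE).
  + by move=> x1 b b' x2; rewrite (pre_lactA PE) (pre_rip_lact PE).
Qed.

End StrongBimodules.

(** * Isomorphisms and the Picard groupoid *)

Section Isomorphisms.
Variables (R : realDomainType) (H : hopf_star_alg R).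

(** Serves to compare two Sweedler sums over the same [g]: both run over the same representative of
    the coproduct, so it is enough that their terms are related one by one. *)
Lemma in_span_pair_sum (K : pzRingType) (U V : lmodType K) (P : U * V -> Prop)
    I (r : seq I) (F : I -> U) (G : I -> V) :
  (forall i, in_span P (F i, G i)) ->
  in_span P (\sum_(i <- r) F i, \sum_(i <- r) G i).
Proof.
move=> PFG; elim: r => [|i r IH]; first by rewrite !big_nil; apply: in_span0.
rewrite !big_cons; exact: (in_spanD (PFG i) IH).
Qed.

Section Relation.
Variables (B A : Hstar_alg H) (E E' : bimod B A).
Hypotheses (EE : is_equiv_bimod E) (EE' : is_equiv_bimod E').
Let PE := equiv_pre EE.
Let PE' := equiv_pre EE'.
Variable rel : E -> E' -> Prop.

Let relp (p : E * E') : Prop := rel p.1 p.2.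

Hypothesis rel_spansl : spans (fun x => exists x', rel x x').
Hypothesis rel_spansr : spans (fun x' => exists x, rel x x').
Hypothesis rel_rip : forall x x' y y',
  rel x x' -> rel y y' -> rip x y = rip x' y'.
Hypothesis rel_lip : forall x x' y y',
  rel x x' -> rel y y' -> lip x y = lip x' y'.
Hypothesis rel_act : forall g x x',
  rel x x' -> in_span relp (bm_act g x, bm_act g x').

Lemma span_rel_rip p q :
  in_span relp p -> in_span relp q -> rip p.1 q.1 = rip p.2 q.2.
Proof.
move=> Dp Dq; elim/in_span_ind: Dp => [|c u v ru IH].
  by rewrite !(additive_map0 (ripDl _ _)).
rewrite /= (ripDl PE) (ripDl PE') (ripZl PE) (ripZl PE') IH; congr (_ *: _ + _).
elim/in_span_ind: Dq => [|d u' v' ru' IH'].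
  by rewrite (additive_map0 (ripDr PE _)) (additive_map0 (ripDr PE' _)).
rewrite /= (ripDr PE) (ripDr PE') (ripZr PE) (ripZr PE') IH'.
by rewrite (rel_rip ru ru').
Qed.

Lemma span_rel_lip p q :
  in_span relp p -> in_span relp q -> lip p.1 q.1 = lip p.2 q.2.
Proof.
move=> Dp Dq; elim/in_span_ind: Dp => [|c u v ru IH].
  by rewrite !(additive_map0 (lipDl _ _)).
rewrite /= (lipDl PE) (lipDl PE') (lipZl PE) (lipZl PE') IH; congr (_ *: _ + _).
elim/in_span_ind: Dq => [|d u' v' ru' IH'].
  by rewrite (additive_map0 (lipDr PE _)) (additive_map0 (lipDr PE' _)).
rewrite /= (lipDr PE) (lipDr PE') (lipZr PE) (lipZr PE') IH'.
by rewrite (rel_lip ru ru').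
Qed.

Lemma span_rel_total x : exists x', in_span relp (x, x').
Proof.
elim/in_span_ind: (rel_spansl x) => [|c u v [u' ru] [v' Dv]].
  by exists 0; apply: in_span0.
have Du : in_span relp (u, u') by apply: in_span_gen.
by exists (c *: u' + v'); exact: (in_spanD (in_spanZ c Du) Dv).
Qed.

Lemma span_rel_surj x' : exists x, in_span relp (x, x').
Proof.
elim/in_span_ind: (rel_spansr x') => [|c u' v' [u ru] [v Dv]].
  by exists 0; apply: in_span0.
have Du : in_span relp (u, u') by apply: in_span_gen.
by exists (c *: u + v); exact: (in_spanD (in_spanZ c Du) Dv).
Qed.

Lemma span_rel_act g p : in_span relp p -> in_span relp (bm_act g p.1, bm_act g p.2).
Proof.
apply: (@in_span_map _ _ _ relp relp (fun p => (bm_act g p.1, bm_act g p.2)) id).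
- by move=> u v /=; rewrite (bm_actDr PE) (bm_actDr PE').
- by move=> c u /=; rewrite (bm_actZr PE) (bm_actZr PE').
- by move=> u ru; apply: rel_act.
Qed.

(* Non-degeneracy makes the span of rel the graph of a bijection; compatibility
   with both module structures is then automatic. *)
Lemma bimod_iso_of_rel : bimod_iso E E'.
Proof.
pose f x := projT1 (cid (span_rel_total x)).
have Df x : in_span relp (x, f x) := projT2 (cid (span_rel_total x)).
pose f' x' := projT1 (cid (span_rel_surj x')).
have Df' x' : in_span relp (f' x', x') := projT2 (cid (span_rel_surj x')).
(* The span of the relation is single-valued: an arbitrary [w'] has the partner [f' w'], and pairing
   with it shows that all partners of [x] have the same inner products with [w']. *)
have fE x x' : in_span relp (x, x') -> f x = x'.
  move=> Dx; apply: (rip_ext EE') => w'.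
  by rewrite -(span_rel_rip (Df' w') (Df x)) -(span_rel_rip (Df' w') Dx).
have fK : cancel f f'.
  move=> x; apply: (rip_ext EE) => w.
  by rewrite (span_rel_rip (Df w) (Df' (f x))) (span_rel_rip (Df w) (Df x)).
have f'K : cancel f' f by move=> x'; apply: fE.
have frip x y : rip (f x) (f y) = rip x y by rewrite -(span_rel_rip (Df x) (Df y)).
have flip x y : lip (f x) (f y) = lip x y by rewrite -(span_rel_lip (Df x) (Df y)).
exists f; split=> //.
- by move=> c x y; apply: fE; apply: (in_spanD (in_spanZ c (Df x)) (Df y)).
- by exists f'.
- split=> [b x|x a].
    apply: (lip_ext EE') => w'; rewrite -[w']f'K flip (pre_lip_lact PE).
    by rewrite (pre_lip_lact PE') flip.
  apply: (rip_ext EE') => w'; rewrite -[w']f'K frip (pre_rip_ract PE).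
  by rewrite (pre_rip_ract PE') frip.
- by move=> g x; apply: fE; apply: (span_rel_act g (Df x)).
Qed.

End Relation.

Lemma bimod_iso_refl (B A : Hstar_alg H) (E : bimod B A) : bimod_iso E E.
Proof. by exists id; split=> //; exists id. Qed.

Lemma bimod_iso_sym (B A : Hstar_alg H) (E E' : bimod B A) :
  bimod_iso E E' -> bimod_iso E' E.
Proof.
case=> f [fL [f' fK f'K] [fl fr] [flip frip] fact].
exists f'; split; [|by exists f|split|split|].
- by move=> c x y; apply: (can_inj fK); rewrite fL !f'K.
- by move=> b x; apply: (can_inj fK); rewrite fl !f'K.
- by move=> x a; apply: (can_inj fK); rewrite fr !f'K.
- by move=> x y; rewrite -flip !f'K.
- by move=> x y; rewrite -frip !f'K.
- by move=> g x; apply: (can_inj fK); rewrite fact !f'K.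
Qed.

Lemma bimod_iso_trans (B A : Hstar_alg H) (E E' E'' : bimod B A) :
  bimod_iso E E' -> bimod_iso E' E'' -> bimod_iso E E''.
Proof.
case=> f [fL fB [fl fr] [flip frip] fact] [h [hL hB [hl hr] [hlip hrip] hact]].
exists (h \o f); split; [|exact: bij_comp|split|split|].
- by move=> c x y /=; rewrite fL hL.
- by move=> b x /=; rewrite fl hl.
- by move=> x a /=; rewrite fr hr.
- by move=> x y /=; rewrite hlip flip.
- by move=> x y /=; rewrite hrip frip.
- by move=> g x /=; rewrite fact hact.
Qed.

Lemma conj_iso (B A : Hstar_alg H) (E E' : bimod B A) :
  bimod_iso E E' -> bimod_iso (conj_bimod E) (conj_bimod E').
Proof.
case=> f [fL fB [fl fr] [flip frip] fact]; exists f; split=> //=.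
- by move=> c x y; apply: fL.
- by split=> *; [apply: fr | apply: fl].
- by move=> g x; apply: fact.
Qed.

Lemma ipure_spans (C B A : Hstar_alg H) (F : bimod C B) (E : bimod B A) :
  spans (fun q : itens_bimod F E => exists y x, q = ipure y x).
Proof. by apply: spans_itens => y x; apply: in_span_gen; exists y, x. Qed.

(** Relating simple tensors to their images spares the verification that f (x) h is balanced and
    respects the degeneracy spaces. *)
Lemma itens_iso (C B A : Hstar_alg H) (F F' : bimod C B) (E E' : bimod B A) :
  is_equiv_bimod F -> is_equiv_bimod F' -> is_equiv_bimod E -> is_equiv_bimod E' ->
  bimod_iso F F' -> bimod_iso E E' ->
  bimod_iso (itens_bimod F E) (itens_bimod F' E').
Proof.
move=> FF FF' EE EE' [f [fL [f' _ f'K] [fl fr] [flip frip] fact]].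
move=> [h [hL [h' _ h'K] [hl hr] [hlip hrip] hact]].
have WD := itens_wd FF EE; have WD' := itens_wd FF' EE'.
apply: (@bimod_iso_of_rel _ _ _ _ (itens_equiv FF EE) (itens_equiv FF' EE')
  (fun q q' => exists y x, q = ipure y x /\ q' = ipure (f y) (h x))).
- move=> q; apply: in_span_trans (ipure_spans q) => _ [y [x ->]].
  by apply: in_span_gen; exists (ipure (f y) (h x)), y, x.
- move=> q; apply: in_span_trans (ipure_spans q) => _ [y [x ->]].
  by apply: in_span_gen; exists (ipure (f' y) (h' x)), (f' y), (h' x);
    rewrite f'K h'K.
- move=> _ _ _ _ [y [x [-> ->]]] [y' [x' [-> ->]]].
  by rewrite (itens_rip WD) (itens_rip WD') frip -hl hrip.
- move=> _ _ _ _ [y [x [-> ->]]] [y' [x' [-> ->]]].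
  by rewrite (itens_lip WD) (itens_lip WD') hlip -fr flip.
- move=> g _ _ [y [x [-> ->]]]; rewrite (itens_act WD) (itens_act WD').
  apply: in_span_pair_sum => p; apply: in_span_gen.
  by exists (bm_act p.1 y), (bm_act p.2 x); rewrite fact hact.
Qed.

Lemma itens_assoc (D C B A : Hstar_alg H)
    (G : bimod D C) (F : bimod C B) (E : bimod B A) :
  is_equiv_bimod G -> is_equiv_bimod F -> is_equiv_bimod E ->
  bimod_iso (itens_bimod G (itens_bimod F E)) (itens_bimod (itens_bimod G F) E).
Proof.
move=> GG FF EE; have FE := itens_equiv FF EE; have GF := itens_equiv GG FF.
have W1 := itens_wd FF EE; have W2 := itens_wd GG FF.
have W3 := itens_wd GG FE; have W4 := itens_wd GF EE.
have PG := equiv_pre GG; have PF := equiv_pre FF; have PE := equiv_pre EE.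
apply: (@bimod_iso_of_rel _ _ _ _ (itens_equiv GG FE) (itens_equiv GF EE)
  (fun q q' => exists z y x,
    q = ipure z (ipure y x) /\ q' = ipure (ipure z y) x)).
- apply: spans_itens => z q; move: (ipure_spans q).
  apply: (@in_span_map _ _ _ _ _ (@ipure _ _ _ _ _ G (itens_bimod F E) z) id).
  + exact: ipureDr.
  + by move=> c x; apply: ipureZr.
  + move=> _ [y [x ->]]; apply: in_span_gen.
    by exists (ipure (ipure z y) x), z, y, x.
- apply: spans_itens => q x; move: (ipure_spans q).
  apply: (@in_span_map _ _ _ _ _
    (fun q => @ipure _ _ _ _ _ (itens_bimod G F) E q x) id).
  + by move=> q1 q2; apply: ipureDl.
  + by move=> c q1; apply: ipureZl.
  + move=> _ [z [y ->]]; apply: in_span_gen.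
    by exists (ipure z (ipure y x)), z, y, x.
- move=> _ _ _ _ [z [y [x [-> ->]]]] [z' [y' [x' [-> ->]]]].
  rewrite (itens_rip W3) (itens_rip W4) (itens_lact W1).
  by rewrite (itens_rip W1) (itens_rip W2).
- move=> _ _ _ _ [z [y [x [-> ->]]]] [z' [y' [x' [-> ->]]]].
  rewrite (itens_lip W3) (itens_lip W4) (itens_ract W2).
  by rewrite (itens_lip W1) (itens_lip W2).
- move=> g _ _ [z [y [x [-> ->]]]]; rewrite (itens_act W3) (itens_act W4).
  pose f a b c : itens_bimod (itens_bimod G F) E :=
    ipure (ipure (bm_act a z) (bm_act b y)) (bm_act c x).
  (* One member is rebracketed so that the iterated Sweedler sums in both components run over the
     same representatives and can be compared termwise. *)
  have -> : \sw[p, c <- g] (ipure (bm_act p (ipure z y)) (bm_act c x)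
        : itens_bimod (itens_bimod G F) E)
      = \sw[a, p <- g] \sw[b, c <- p] f a b c.
    rewrite -sw_coassoc; last first.
      by split=> ?; split=> *;
        rewrite /f ?(bm_actDl PG) ?(bm_actDl PF) ?(bm_actDl PE) ?(ipureDl, ipureDr)
        // ?(bm_actZl PG) ?(bm_actZl PF) ?(bm_actZl PE) ?(ipureZl, ipureZr).
    apply: eq_tlift => p c; rewrite (itens_act W2).
    by rewrite (tlift_map _ _ (fun q q' => ipureDl q q' _)).
  apply: in_span_pair_sum => p; rewrite (itens_act W1).
  rewrite (tlift_map _ _ (@ipureDr _ _ _ _ _ G (itens_bimod F E) _)).
  apply: in_span_pair_sum => q; apply: in_span_gen.
  by exists (bm_act p.1 z), (bm_act q.1 y), (bm_act q.2 x).
Qed.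

Lemma itens_canonicall (B A : Hstar_alg H) (E : bimod B A) :
  is_equiv_bimod E -> bimod_iso (itens_bimod (canonical_bimod B) E) E.
Proof.
move=> EE; have BB := canonical_equiv B; have W := itens_wd BB EE.
have PE := equiv_pre EE.
apply: (@bimod_iso_of_rel _ _ _ _ (itens_equiv BB EE) EE
  (fun q x' => exists (b : canonical_bimod B) x, q = ipure b x /\ x' = lact b x)).
- move=> q; apply: in_span_trans (ipure_spans q) => _ [b [x ->]].
  by apply: in_span_gen; exists (lact (b : B) x), b, x.
- move=> x; apply: in_span_trans (pre_lact_spans PE x) => _ [b [y ->]].
  by apply: in_span_gen; exists (@ipure _ _ _ _ _ (canonical_bimod B) E b y), b, y.
- move=> _ _ _ _ [b [x [-> ->]]] [b' [x' [-> ->]]].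
  by rewrite (itens_rip W) /= (pre_lactA PE) (pre_rip_lact PE).
- move=> _ _ _ _ [b [x [-> ->]]] [b' [x' [-> ->]]].
  by rewrite (itens_lip W) /= (pre_lip_lact PE) (lip_lactr PE) sa_mulA.
- move=> g _ _ [b [x [-> ->]]]; rewrite (itens_act W) (bm_act_lact EE).
  apply: in_span_pair_sum => p; apply: in_span_gen.
  by exists (ha_act p.1 b), (bm_act p.2 x).
Qed.

Lemma itens_canonicalr (B A : Hstar_alg H) (E : bimod B A) :
  is_equiv_bimod E -> bimod_iso (itens_bimod E (canonical_bimod A)) E.
Proof.
move=> EE; have AA := canonical_equiv A; have W := itens_wd EE AA.
have PE := equiv_pre EE.
apply: (@bimod_iso_of_rel _ _ _ _ (itens_equiv EE AA) EE
  (fun q x' => exists x (a : canonical_bimod A), q = ipure x a /\ x' = ract x a)).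
- move=> q; apply: in_span_trans (ipure_spans q) => _ [x [a ->]].
  by apply: in_span_gen; exists (ract x (a : A)), x, a.
- move=> x; apply: in_span_trans (pre_ract_spans PE x) => _ [y [a ->]].
  by apply: in_span_gen; exists (@ipure _ _ _ _ _ E (canonical_bimod A) y a), y, a.
- move=> _ _ _ _ [x [a [-> ->]]] [x' [a' [-> ->]]].
  by rewrite (itens_rip W) /= (rip_ractl PE) (pre_rip_ract PE).
- move=> _ _ _ _ [x [a [-> ->]]] [x' [a' [-> ->]]].
  by rewrite (itens_lip W) /= (lip_ractr PE) (pre_ractA PE).
- move=> g _ _ [x [a [-> ->]]]; rewrite (itens_act W) (bm_act_ract EE).
  apply: in_span_pair_sum => p; apply: in_span_gen.
  by exists (bm_act p.1 x), (ha_act p.2 a).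
Qed.

(** The inner products match by the compatibility axiom: the B-valued product of x and x' applied to
    y' is x <x', y'>, so its inner product with y is <y, x> <x', y'>, the canonical inner product of
    <x, y> and <x', y'>. Fullness makes the relation reach all of A. *)
Lemma itens_conjl (B A : Hstar_alg H) (E : bimod B A) :
  is_equiv_bimod E -> bimod_iso (itens_bimod (conj_bimod E) E) (canonical_bimod A).
Proof.
move=> EE; have CC := conj_equiv EE; have W := itens_wd CC EE.
have PE := equiv_pre EE.
apply: (@bimod_iso_of_rel _ _ _ _ (itens_equiv CC EE) (canonical_equiv A)
  (fun q a => exists (x : conj_bimod E) (y : E),
    q = ipure x y /\ a = rip (x : E) y)).
- move=> q; apply: in_span_trans (ipure_spans q) => _ [x [y ->]].
  by apply: in_span_gen; exists (rip (x : E) y), x, y.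
- move=> a; apply: in_span_trans (pre_rip_full PE a) => _ [x [y ->]].
  by apply: in_span_gen; exists (@ipure _ _ _ _ _ (conj_bimod E) E x y), x, y.
- move=> _ _ _ _ [x [y [-> ->]]] [x' [y' [-> ->]]].
  by rewrite (itens_rip W) /= (pre_lip_rip PE) (pre_rip_ract PE) -(pre_rip_sym PE).
- move=> _ _ _ _ [x [y [-> ->]]] [x' [y' [-> ->]]].
  rewrite (itens_lip W) /= (pre_rip_lact PE) sa_starK (pre_lip_rip PE).
  by rewrite (pre_rip_ract PE) -(pre_rip_sym PE).
- move=> g _ _ [x [y [-> ->]]]; rewrite (itens_act W) /= (pre_act_rip PE).
  apply: in_span_pair_sum => p; apply: in_span_gen.
  by exists (bm_act (starS p.1) (x : E)), (bm_act p.2 y).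
Qed.

Lemma itens_conjr (B A : Hstar_alg H) (E : bimod B A) :
  is_equiv_bimod E -> bimod_iso (itens_bimod E (conj_bimod E)) (canonical_bimod B).
Proof.
move=> EE; have CC := conj_equiv EE; have W := itens_wd EE CC.
have PE := equiv_pre EE.
apply: (@bimod_iso_of_rel _ _ _ _ (itens_equiv EE CC) (canonical_equiv B)
  (fun q b => exists (x : E) (y : conj_bimod E),
    q = ipure x y /\ b = lip x (y : E))).
- move=> q; apply: in_span_trans (ipure_spans q) => _ [x [y ->]].
  by apply: in_span_gen; exists (lip x (y : E)), x, y.
- move=> a; apply: in_span_trans (pre_lip_full PE a) => _ [x [y ->]].
  by apply: in_span_gen; exists (@ipure _ _ _ _ _ E (conj_bimod E) x y), x, y.
- move=> _ _ _ _ [x [y [-> ->]]] [x' [y' [-> ->]]].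
  rewrite (itens_rip W) /= -(pre_lip_ract PE) -(pre_lip_rip PE).
  by rewrite (pre_lip_lact PE) -(pre_lip_sym PE).
- move=> _ _ _ _ [x [y [-> ->]]] [x' [y' [-> ->]]].
  rewrite (itens_lip W) /= -(pre_lip_rip PE).
  by rewrite (pre_lip_lact PE) -(pre_lip_sym PE).
- move=> g _ _ [x [y [-> ->]]]; rewrite (itens_act W) /= (pre_act_lip PE).
  apply: in_span_pair_sum => p; apply: in_span_gen.
  by exists (bm_act p.1 x), (bm_act (starS p.2) (y : E)).
Qed.

End Isomorphisms.

(** * The groupoid of a kind of equivalence bimodules closed under the operations *)

Section Picard.
Variables (R : realDomainType) (H : hopf_star_alg R).
Variable K : forall B A : Hstar_alg H, bimod B A -> Prop.
Hypothesis K_equiv : forall B A (E : bimod B A), K E -> is_equiv_bimod E.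
Hypothesis K_canonical : forall A, K (canonical_bimod A).
Hypothesis K_conj : forall B A (E : bimod B A), K E -> K (conj_bimod E).
Hypothesis K_itens : forall C B A (F : bimod C B) (E : bimod B A),
  K F -> K E -> K (itens_bimod F E).

Lemma pic_class_eq B A (E E' : bimod B A) (KE : K E) (KE' : K E') :
  pic_class KE = pic_class KE' <-> bimod_iso E E'.
Proof.
split=> [e|i].
  (* Classes are predicates, and the class of [E] evaluated at [E'] is the claim itself; the
     equality of classes reduces it to reflexivity. *)
  rewrite -[bimod_iso E E']/(sval (pic_class KE) (exist _ E' KE')) e.
  exact: bimod_iso_refl.
apply: eq_exist; apply: funext => -[E'' KE'']; apply: propext; rewrite /iso_class /=.
split; apply: bimod_iso_trans => //; exact: bimod_iso_sym.
Qed.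

Lemma pic_classP B A (X : Pic K B A) :
  exists E : Kbimod K B A, X = pic_class (svalP E).
Proof.
case: X => X [[E KE] XE]; exists (exist _ E KE).
exact: eq_exist.
Qed.

(** Composition and inversion are defined on representatives obtained by choice; [compE] and [invE]
    below then show that any representative gives the same class, so the groupoid laws reduce to
    isomorphisms of bimodules. *)
Let rep B A (X : Pic K B A) : Kbimod K B A := projT1 (cid (pic_classP X)).

Lemma rep_class B A (E : bimod B A) (KE : K E) :
  bimod_iso (sval (rep (pic_class KE))) E.
Proof.
apply/bimod_iso_sym/(pic_class_eq KE (svalP (rep (pic_class KE)))).
exact: (projT2 (cid (pic_classP (pic_class KE)))).
Qed.

Lemma Picard_groupoid : is_Picard_groupoid K.
Proof.
pose comp A B C (Y : Pic K C B) (X : Pic K B A) : Pic K C A :=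
  pic_class (K_itens (svalP (rep Y)) (svalP (rep X))).
pose unit A : Pic K A A := pic_class (K_canonical A).
pose inv A B (X : Pic K B A) : Pic K A B := pic_class (K_conj (svalP (rep X))).
have compE A B C (F : bimod C B) (E : bimod B A) (KF : K F) (KE : K E) :
    comp _ _ _ (pic_class KF) (pic_class KE) = pic_class (K_itens KF KE).
  apply/pic_class_eq/itens_iso; try exact: rep_class; apply: K_equiv => //;
    exact: svalP.
have invE A B (E : bimod B A) (KE : K E) :
    inv _ _ (pic_class KE) = pic_class (K_conj KE).
  exact/pic_class_eq/conj_iso/rep_class.
exists comp, unit, inv; split.
- split.
  + move=> A B C D h g f.
    have [[G KG] ->] := pic_classP h; have [[F KF] ->] := pic_classP g.
    have [[E KE] ->] := pic_classP f; rewrite !compE.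
    by apply/pic_class_eq/itens_assoc; apply: K_equiv.
  + move=> A B f; have [[E KE] ->] := pic_classP f; rewrite compE.
    by apply/pic_class_eq/itens_canonicall; apply: K_equiv.
  + move=> A B f; have [[E KE] ->] := pic_classP f; rewrite compE.
    by apply/pic_class_eq/itens_canonicalr; apply: K_equiv.
  + move=> A B f; have [[E KE] ->] := pic_classP f; rewrite invE compE.
    by apply/pic_class_eq/itens_conjl; apply: K_equiv.
  + move=> A B f; have [[E KE] ->] := pic_classP f; rewrite invE compE.
    by apply/pic_class_eq/itens_conjr; apply: K_equiv.
- move=> A B C F E KF KE; split; first by apply: itens_wd; apply: K_equiv.
  by exists (K_itens KF KE); apply: compE.
- by move=> A; exists (K_canonical A).
- by move=> A B E KE; exists (K_conj KE); apply: invE.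
Qed.

End Picard.

Theorem theorem4p2 (R : realDomainType) (H : hopf_star_alg R) :
  is_Picard_groupoid (@is_equiv_bimod R H) /\
  is_Picard_groupoid (@is_strong_equiv_bimod R H).
Proof.
split; apply: Picard_groupoid.
- by [].
- exact: canonical_equiv.
- by move=> B A E; apply: conj_equiv.
- by move=> C B A F E; apply: itens_equiv.
- by move=> B A E [].
- exact: canonical_strong.
- by move=> B A E; apply: conj_strong.
- by move=> C B A F E; apply: itens_strong.
Qed.
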